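(* Suppose $d=1$. The following are equivalent: (a) $[\omega]_{-a}R$ is a faithful $R$-module; (b) $J^{i}:\mathfrak m^{a+1}=\mathfrak m^{i}$ for every $i$; (c) $J^{i}:\mathfrak m^{a+1}=\mathfrak m^{i}$ for some $i\ge a+1$.
   Context: $k$ is a field and $R$ is a standard graded Cohen-Macaulay $k$-algebra (so $[R]_0=k$ and $R$ is generated over $k$ by finitely many elements of degree $1$) of dimension $d=1$, with homogeneous maximal ideal $\mathfrak m$ and graded canonical module $\omega=\omega_R$, normalized as usual (if $R=S/I$ with $S=k[X_1,\dots,X_n]$ a standard graded polynomial ring and $I$ a homogeneous ideal of height $g$, then $\omega_R\cong \mathrm{Ext}^g_S(R,S(-n))$). For a graded module $M$, $[M]_i$ is the degree $i$ component and $[M]_tR$ is the submodule generated by $[M]_t$. The $a$-invariant is $a=a(R)=-\min\{i : [\omega]_i\ne 0\}$. $J=(y_1)$, where $y_1$ is a linear form that is a system of parameters of $R$. Convention: powers of ideals with non-positive exponent are the unit ideal. Colons are taken in $R$. *)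

(* Defs.v *)
From HB Require Import structures.
From mathcomp Require Import all_boot all_order all_algebra.
From mathcomp Require Import mpoly.

Set Implicit Arguments.
Unset Strict Implicit.
Unset Printing Implicit Defensive.

Import Order.TTheory GRing.Theory Num.Theory.
Local Open Scope ring_scope.

(* Subsets are predicates [T -> Prop]: no decidability is assumed of ideals,
   submodules or graded pieces. *)

(* [faithful N] says that Ann_R(N) = 0. *)
Section Submodules.
Variables (R : comNzRingType) (V : lmodType R).

Definition submod_gen (X : V -> Prop) (v : V) : Prop :=
  exists s : seq (R * V),
    (forall p, p \in s -> X p.2) /\ v = \sum_(p <- s) p.1 *: p.2.

Definition faithful (N : V -> Prop) : Prop :=
  forall r : R, (forall v, N v -> r *: v = 0) -> r = 0.

End Submodules.

Section Ideals.
Variable R : comNzRingType.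
Implicit Types I J P : R -> Prop.

Definition is_ideal I : Prop :=
  [/\ I 0, (forall x y, I x -> I y -> I (x + y)) & (forall r x, I x -> I (r * x))].

Definition ideal_gen (X : R -> Prop) : R -> Prop := @submod_gen R R^o X.

Definition ideal_of_seq (xs : seq R) : R -> Prop := ideal_gen (fun z => z \in xs).

Definition sub_ideal I J : Prop := forall r, I r -> J r.

Definition eq_ideal I J : Prop := forall r, I r <-> J r.

Definition ideal_mul I J : R -> Prop :=
  ideal_gen (fun z => exists x y, [/\ I x, J y & z = x * y]).

Fixpoint ideal_pow I (n : nat) : R -> Prop :=
  if n is n'.+1 then ideal_mul I (ideal_pow I n') else fun=> True.

(* Powers with non-positive exponent are the unit ideal. *)
Definition ideal_powz I (i : int) : R -> Prop :=
  if i is Posz n then ideal_pow I n else fun=> True.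

Definition colon I J : R -> Prop := fun r => forall s, J s -> I (r * s).

Definition prime_ideal P : Prop :=
  [/\ is_ideal P, ~ P 1 & forall x y, P (x * y) -> P x \/ P y].

(* c 0 < c 1 < ... < c l, a strict chain of primes of length l; the values
   of c beyond l are irrelevant. *)
Definition prime_chain (l : nat) (c : nat -> R -> Prop) : Prop :=
  (forall i, (i <= l)%N -> prime_ideal (c i)) /\
  (forall i, (i < l)%N -> sub_ideal (c i) (c i.+1) /\ ~ sub_ideal (c i.+1) (c i)).

(* A chain of length l contains chains of all smaller lengths, so it is enough
   to exclude length d + 1. *)
Definition krull_dim (d : nat) : Prop :=
  (exists c, prime_chain d c) /\ ~ (exists c, prime_chain d.+1 c).

Definition prime_height_ge P (h : nat) : Prop :=
  exists c, prime_chain h c /\ eq_ideal (c h) P.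

(* The height of I is the minimum of the heights of the primes containing I. *)
Definition ideal_height I (g : nat) : Prop :=
  (exists P, [/\ prime_ideal P, sub_ideal I P, prime_height_ge P g
               & ~ prime_height_ge P g.+1]) /\
  (forall P, prime_ideal P -> sub_ideal I P -> prime_height_ge P g).

Definition regular_sequence (xs : seq R) : Prop :=
  (forall i, (i < size xs)%N -> forall r,
     ideal_of_seq (take i xs) (xs`_i * r) -> ideal_of_seq (take i xs) r) /\
  ~ ideal_of_seq xs 1.

(* The length of the longest regular sequences in I, i.e. grade(I, R). *)
Definition has_grade I (t : nat) : Prop :=
  (exists xs, [/\ regular_sequence xs, (forall x, x \in xs -> I x)
                & size xs = t]) /\
  (forall xs, regular_sequence xs -> (forall x, x \in xs -> I x) ->
     (size xs <= t)%N).

End Ideals.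

(* A direct sum decomposition of V into the subgroups G i. *)
Definition grading (T : eqType) (V : zmodType) (G : T -> V -> Prop) : Prop :=
  [/\ (forall i, G i 0 /\ (forall u v, G i u -> G i v -> G i (u - v))),
      (forall v, exists (s : seq T) (f : T -> V),
         (forall i, G i (f i)) /\ v = \sum_(i <- s) f i)
    & (forall (s : seq T) (f : T -> V), uniq s -> (forall i, G i (f i)) ->
         \sum_(i <- s) f i = 0 -> forall i, i \in s -> f i = 0)].

(* An N-graded object seen as Z-graded. *)
Definition zgr (V : zmodType) (G : nat -> V -> Prop) (i : int) (v : V) : Prop :=
  if i is Posz m then G m v else v = 0.

Section StandardGraded.
Variables (k : fieldType) (R : comAlgType k) (G : nat -> R -> Prop).

Definition poly_eval (n : nat) (x : 'I_n -> R) (p : {mpoly k[n]}) : R :=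
  mmap (in_alg R) x p.

(* R = S/I with S = k[X_1, ..., X_n] standard graded: X_i is sent to the
   linear form x i, and I is the kernel of the evaluation. *)
Definition presentation (n : nat) (x : 'I_n -> R) : Prop :=
  (forall i, G 1 (x i)) /\ (forall r, exists p, poly_eval x p = r).

Definition standard_graded : Prop :=
  [/\ grading G,
      (forall i j r s, G i r -> G j s -> G (i + j)%N (r * s)),
      (forall r, G 0 r <-> exists c : k, r = c%:A)
    & (exists n (x : 'I_n -> R), presentation x)].

(* The homogeneous maximal ideal. *)
Definition irrelevant : R -> Prop :=
  ideal_gen (fun r => exists2 i, (0 < i)%N & G i r).

(* For a standard graded algebra, grade(m, R) = depth R_m, and R is
   Cohen-Macaulay iff R_m is. *)
Definition cohen_macaulay : Prop :=
  exists d, krull_dim R d /\ has_grade irrelevant d.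

(* dim R elements generating an m-primary ideal. *)
Definition system_of_parameters (ys : seq R) : Prop :=
  [/\ krull_dim R (size ys), (forall y, y \in ys -> irrelevant y)
    & exists N, sub_ideal (ideal_pow irrelevant N) (ideal_of_seq ys)].

Definition graded_module (M : lmodType R) (GM : int -> M -> Prop) : Prop :=
  grading GM /\
  (forall i j r w, G i r -> GM j w -> GM (i%:Z + j) (r *: w)).

Section Resolution.
Variables (n : nat) (x : 'I_n -> R).
Local Notation S := {mpoly k[n]}.

(* [S]_i, with i an integer. *)
Definition mpoly_gr : int -> S -> Prop := zgr (fun m p => p \is m.-homog).

(* A graded free resolution ... -> F_1 -> F_0 -> R -> 0 over S, with
   F_i = (+)_(l < b i) S(- d i l). Elements of F_i are row vectors, the
   differential F_(i+1) -> F_i is v |-> v *m D i, and the augmentation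
   F_0 -> R sends the basis element of index l to e l. *)
Record graded_free_resolution := GradedFreeResolution {
  frank : nat -> nat;
  fdeg : forall i, 'I_(frank i) -> int;
  fdiff : forall i, 'M[S]_(frank i.+1, frank i);
  faug : 'I_(frank 0) -> R;
  fdiff_homog : forall i j l,
    mpoly_gr (fdeg j - fdeg l) (fdiff i j l);
  faug_homog : forall l, zgr G (fdeg l) (faug l);
  faug_surj : forall r, exists v : 'rV[S]_(frank 0),
    \sum_l poly_eval x (v 0 l) * faug l = r;
  faug_exact : forall v : 'rV[S]_(frank 0),
    \sum_l poly_eval x (v 0 l) * faug l = 0 <->
    exists w : 'rV[S]_(frank 1), v = w *m fdiff 0;
  fdiff_exact : forall i (v : 'rV[S]_(frank i.+1)),
    v *m fdiff i = 0 <->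
    exists w : 'rV[S]_(frank i.+2), v = w *m fdiff i.+1 }.

Variable F : graded_free_resolution.

(* The complex Hom_S(F, S(-n)): a map F_i -> S(-n) is the column vector of the
   images of the basis elements. Since [S(-n)]_j = [S]_(j-n), it has degree t
   iff its entry of index l lies in [S]_(t + d i l - n). *)
Definition cochain_degree (i : nat) (t : int) (u : 'cV[S]_(frank F i)) : Prop :=
  forall l, mpoly_gr (t + @fdeg F i l - n%:Z) (u l 0).

Definition cocycle (i : nat) (u : 'cV[S]_(frank F i)) : Prop :=
  fdiff F i *m u = 0.

Definition coboundary (i : nat) : 'cV[S]_(frank F i) -> Prop :=
  match i with
  | 0 => fun u => u = 0
  | j.+1 => fun u => exists w : 'cV[S]_(frank F j), u = fdiff F j *m w
  end.

(* M is isomorphic to Ext^i_S(R, S(-n)) = H^i(Hom_S(F, S(-n))) as a graded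
   S-module, S acting on M through S -> R. A bijective map preserving degrees
   between graded modules is an isomorphism of graded modules. *)
Definition iso_Ext (i : nat) (M : lmodType R) (GM : int -> M -> Prop) : Prop :=
  exists psi : 'cV[S]_(frank F i) -> M,
  [/\ (forall u v, cocycle u -> cocycle v -> psi (u + v) = psi u + psi v),
      (forall p u, cocycle u -> psi (p *: u) = poly_eval x p *: psi u),
      (forall w, exists2 u, cocycle u & psi u = w),
      (forall u, cocycle u -> (psi u = 0 <-> coboundary u))
    & (forall t u, cocycle u -> cochain_degree t u -> GM t (psi u))].

End Resolution.

(* omega_R = Ext^g_S(R, S(-n)) with R = S/I and g the height of I. *)
Definition canonical_module (M : lmodType R) (GM : int -> M -> Prop) : Prop :=
  graded_module GM /\
  exists (n : nat) (x : 'I_n -> R) (g : nat) (F : graded_free_resolution x),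
    [/\ presentation x, ideal_height (fun p => poly_eval x p = 0) g
      & iso_Ext F g GM].

(* a = - min {i : [M]_i <> 0}, to be used with M the canonical module. *)
Definition a_invariant (M : lmodType R) (GM : int -> M -> Prop) (a : int) : Prop :=
  (exists2 w, GM (- a) w & w <> 0) /\
  (forall i w, GM i w -> w <> 0 -> - a <= i).

End StandardGraded.

(* Main.v *)
Require Import Defs.
From HB Require Import structures.
From mathcomp Require Import all_boot all_order all_algebra.
From mathcomp Require Import mpoly ssrcomplements.
From mathcomp Require Import boolp functions.
From mathcomp Require classical_sets.
From mathcomp Require Import zify ring.

(** Write [y] for [y1]. The irrelevant ideal contains a regular element, some
    power of which is a multiple of [y], so [y] is regular. Let
    [T = R / (1 - y) R], which is the degree 0 part of [R[1/y]], and let [V_j] be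
    the image in [T] of the component [R_j]. These images increase with [j].

    Graded duality over [k[y]] identifies the component of degree [-j] of
    [omega] with the functionals on [T] that vanish on [V_j], the action of [R]
    being the evident one. The choice of [a] thus gives [V_j = T] for [j > a],
    and a homogeneous [r] kills the component of degree [-a] if and only if
    [r T] lies in [V_a]. Hence condition (a) says that no nonzero homogeneous
    [r] has [r T] inside [V_a] ([faithful_no_low_ideal]). For [r] of degree
    [j < i], on the other hand, [r m ^ (a + 1)] lies in [J ^ i] if and only if
    [r T] lies in [V_(j + a + 1 - i)], which is contained in [V_a], with
    equality for [j = i - 1]. So (a) gives (b) ([no_low_ideal_colon]).
    Conversely, if [r T] lies in [V_a], then so does the image of [r]; when
    [i > a], it is also the image of some [r'] of degree [i - 1], which then
    belongs to the colon ideal, and equality with [m ^ i] forces [r' = 0]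
    ([colon_no_low_ideal]).

    It remains to prove the duality ([canonical_represented] and
    [represented_canonical]) from the definition of [omega] as an [Ext] module
    computed with an arbitrary free resolution [F] over
    [S = k[X_1, ..., X_n]]. After a linear change of coordinates, [y] is the
    image of a variable [X_i0]. Besides [S] itself, completed to the functions
    on the exponents in [N^n], consider the functions on the exponents in [Z^n]
    with prescribed signs of the coordinates. Letting the sign of coordinate
    [i] be nonnegative, arbitrary or negative gives a short exact sequence of
    [S]-modules. Some power of the image of [X_i] is a multiple of [y], so some
    [X_i ^ N - X_i0 h] annihilates [R]; for [i <> i0] it acts bijectively on
    the middle term ([monic_bijective]), hence the cohomology of [Hom(F, -)]
    vanishes there and the connecting map is an isomorphism
    ([connecting_coh_iso]). After [n - 1] steps, [S] is replaced by the
    functions [L] on the exponents that are negative except in coordinate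
    [i0]: this is a module of [k[[X_i0]]]-valued functionals on [S]. Since [y] is
    regular on [R], the cohomology of [Hom(F, L)] vanishes in positive degrees
    ([last_cone_cohomology_vanishes]), and in degree 0 it consists of the
    functionals on [R]. As [omega] is nonzero, the [Ext] degree is therefore
    [n - 1], and its elements are functionals on [R]. *)

Set Implicit Arguments.
Unset Strict Implicit.
Unset Printing Implicit Defensive.

Import Order.TTheory GRing.Theory Num.Theory.
Local Open Scope ring_scope.

(** * Extension of linear functionals *)

Section LinearExtension.
Variables (k : fieldType) (W : lmodType k).

Definition linear_relation (A : W -> k -> Prop) : Prop :=
  A 0 0 /\ forall c w w' d d', A w d -> A w' d' -> A (c *: w + w') (c * d + d').

(** The graph of a functional defined on a subspace. Graphs are ordered by
    inclusion, which is the form needed for a maximality argument. *)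
Definition functional_relation (A : W -> k -> Prop) : Prop :=
  linear_relation A /\ forall c, A 0 c -> c = 0.

Lemma functional_relation_inj A w c d :
  functional_relation A -> A w c -> A w d -> c = d.
Proof.
move=> [[_ linA] funA] Awc Awd; apply/eqP; rewrite -subr_eq0; apply/eqP/funA.
by have := linA (-1) _ _ _ _ Awd Awc; rewrite scaleN1r addNr mulN1r addrC.
Qed.

(** In a maximal graph every vector has a value, since a vector without one
    can be given the value 0. *)
Lemma linear_functional_extension (A : W -> k -> Prop) :
  functional_relation A ->
  exists lam : W -> k, (forall c w w', lam (c *: w + w') = c * lam w + lam w') /\
                       (forall w d, A w d -> lam w = d).
Proof.
move=> funA.
pose T := {B : W -> k -> Prop | functional_relation B /\ forall w d, A w d -> B w d}.
pose leT (B C : T) := `[< forall w d, sval B w d -> sval C w d >].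
have [||||[M [funM AM]] maxM] := @classical_sets.Zorn T leT.
- by move=> B; apply/asboolP.
- by move=> B C D /asboolP BC /asboolP CD; apply/asboolP => w d /BC /CD.
- move=> [B HB] [C HC] /asboolP /= BC /asboolP /= CB.
  have eBC : B = C.
    by apply/funext => w; apply/funext => d; apply/propext; split; [apply: BC|apply: CB].
  by subst C; congr exist; apply: Prop_irrelevance.
- move=> F totF.
  (* [A] is added to the union because the chain may be empty. *)
  pose U w d := A w d \/ exists2 B : T, F B & sval B w d.
  have UT : functional_relation U /\ forall w d, A w d -> U w d.
    split; last by left.
    have lin2 B : functional_relation B -> (forall w d, B w d -> U w d) ->
        forall c w w' d d', B w d -> B w' d' -> U (c *: w + w') (c * d + d').
      by move=> [[_ linB] _] BU *; apply: BU; apply: linB.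
    split; last first.
      by move=> c [|[B FB]]; [have [_] := funA; apply | have [[_ +] _] := svalP B; apply].
    split; first by left; have [[]] := funA.
    move=> c w w' d d' [Awd|[B FB Bwd]] [Awd'|[C FC Cwd]].
    + by apply: (lin2 A) => //; left.
    + have [fC subC] := svalP C; apply: (lin2 (sval C)) => //; last exact: subC.
      by right; exists C.
    + have [fB subB] := svalP B; apply: (lin2 (sval B)) => //; last exact: subB.
      by right; exists B.
    + have [fB _] := svalP B; have [fC _] := svalP C.
      have [/asboolP BC|/asboolP CB] := totF _ _ FB FC.
      * by apply: (lin2 (sval C)) => //; [right; exists C | apply: BC].
      * by apply: (lin2 (sval B)) => //; [right; exists B | apply: CB].
  exists (exist _ U UT) => B FB; apply/asboolP => w d Bwd; right; by exists B.
have totalM w : exists d, M w d.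
  apply: contrapT => noMw.
  have [[M0 linM] zM] := funM.
  (* The extension of [M] that sends [w] to 0. *)
  pose N v d := exists c v' d', [/\ M v' d', v = c *: w + v' & d = d'].
  have MN v d : M v d -> N v d.
    by move=> Mvd; exists 0, v, d; rewrite scale0r add0r.
  have NT : functional_relation N /\ forall v d, A v d -> N v d.
    split; last by move=> v d /AM; apply: MN.
    split.
      split; first exact: MN.
      move=> c _ _ _ _ [c1 [v1 [d1 [M1 -> ->]]]] [c2 [v2 [d2 [M2 -> ->]]]].
      exists (c * c1 + c2), (c *: v1 + v2), (c * d1 + d2); split=> //; first exact: linM.
      by rewrite scalerDr scalerDl !scalerA addrACA.
    move=> _ [c [v [d [Mvd e0 ->]]]].
    have [c0|c_neq0] := eqVneq c 0.
      by move: e0; rewrite c0 scale0r add0r => e0; apply: zM; rewrite e0.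
    case: noMw; exists (- c^-1 * d); have := linM (- c^-1) _ _ _ _ Mvd M0.
    rewrite !addr0; have -> // : - c^-1 *: v = w.
    have -> : v = - (c *: w) by apply/eqP; rewrite -subr_eq0 opprK addrC -e0.
    by rewrite scalerN scaleNr opprK scalerA mulVf // scale1r.
  have /(congr1 sval)/= NM : exist _ N NT = exist _ M (conj funM AM) :> T.
    by apply: maxM; apply/asboolP.
  apply: noMw; exists 0; rewrite -NM.
  by exists 1, 0, 0; rewrite scale1r addr0.
have [lam Mlam] := choice totalM.
exists lam; split=> [c w w'|w d /AM Mwd]; last exact: (functional_relation_inj funM (Mlam w) Mwd).
apply: (functional_relation_inj funM (Mlam _)).
by have [[_ linM] _] := funM; apply: linM.
Qed.

End LinearExtension.

(** * Cohomology of the dual of a free resolution *)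

Section Complexes.
Variables (S : comNzRingType) (b : nat -> nat) (D : forall i, 'M[S]_(b i.+1, b i)).

Definition mxact (N : lmodType S) p q (A : 'M[S]_(p, q)) (u : 'I_q -> N) : 'I_p -> N :=
  fun i => \sum_j A i j *: u j.

Lemma mxactD (N : lmodType S) p q (A : 'M[S]_(p, q)) (u v : 'I_q -> N) :
  mxact A (u + v) = mxact A u + mxact A v.
Proof.
apply/funext => i; rewrite /mxact -[RHS]big_split /=.
by apply: eq_bigr => j _; rewrite scalerDr.
Qed.

Lemma mxactN (N : lmodType S) p q (A : 'M[S]_(p, q)) (u : 'I_q -> N) :
  mxact A (- u) = - mxact A u.
Proof.
apply/funext => i; rewrite /mxact -[RHS]sumrN /=.
by apply: eq_bigr => j _; rewrite scalerN.
Qed.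

Lemma mxactB (N : lmodType S) p q (A : 'M[S]_(p, q)) (u v : 'I_q -> N) :
  mxact A (u - v) = mxact A u - mxact A v.
Proof. by rewrite mxactD mxactN. Qed.

Lemma mxact0 (N : lmodType S) p q (A : 'M[S]_(p, q)) : mxact A (0 : 'I_q -> N) = 0.
Proof. by apply/funext => i; rewrite /mxact big1 // => j _; rewrite scaler0. Qed.

Lemma mxactZ (N : lmodType S) p q (A : 'M[S]_(p, q)) c (u : 'I_q -> N) :
  mxact A (fun j => c *: u j) = (fun i => c *: mxact A u i).
Proof.
apply/funext => i; rewrite /mxact scaler_sumr; apply: eq_bigr => j _.
by rewrite !scalerA mulrC.
Qed.

Lemma mxactDl (N : lmodType S) p q (A B : 'M[S]_(p, q)) (u : 'I_q -> N) :
  mxact (A + B) u = mxact A u + mxact B u.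
Proof.
apply/funext => i; rewrite /mxact -[RHS]big_split /=.
by apply: eq_bigr => j _; rewrite mxE scalerDl.
Qed.

Lemma mxactM (N : lmodType S) p q r (A : 'M[S]_(p, q)) (B : 'M[S]_(q, r)) (u : 'I_r -> N) :
  mxact (A *m B) u = mxact A (mxact B u).
Proof.
apply/funext => i; rewrite /mxact.
under eq_bigr => j _ do rewrite mxE scaler_suml.
rewrite exchange_big /=; apply: eq_bigr => j _; rewrite scaler_sumr.
by apply: eq_bigr => l _; rewrite scalerA.
Qed.

Lemma mxact_scalar (N : lmodType S) p c (u : 'I_p -> N) :
  mxact c%:M u = (fun i => c *: u i).
Proof.
apply/funext => i; rewrite /mxact (bigD1 i) //= mxE eqxx big1 ?addr0 // => j ne_ji.
by rewrite mxE eq_sym (negPf ne_ji) scale0r.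
Qed.

Lemma mxact_map (N N' : lmodType S) (f : {linear N -> N'}) p q (A : 'M[S]_(p, q)) u :
  mxact A (f \o u) = f \o mxact A u.
Proof.
by apply/funext => i; rewrite /mxact /= linear_sum; apply: eq_bigr => j _; rewrite linearZ.
Qed.

(** A homomorphism [F_i -> N] is the family of the images of the basis
    elements, so the differentials of [Hom_S(F, N)] are matrix actions. *)
Definition cocyc (N : lmodType S) i (u : 'I_(b i) -> N) : Prop := mxact (D i) u = 0.

Definition cobound (N : lmodType S) i : ('I_(b i) -> N) -> Prop :=
  match i with
  | 0 => fun u => u = 0
  | j.+1 => fun u => exists w, u = mxact (D j) w
  end.

Definition acyclic_complex : Prop :=
  (forall i, D i.+1 *m D i = 0) /\
  (forall i (v : 'rV_(b i.+1)), v *m D i = 0 -> exists w, v = w *m D i.+1).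

(** The module resolved by [D] is the cokernel of [D 0]; the condition says that
    [p] annihilates it. *)
Definition kills_coker (p : S) : Prop :=
  forall v : 'rV_(b 0), exists w, p *: v = w *m D 0.

Lemma row_lift m p q r (A : 'M[S]_(m, p)) (B : 'M[S]_(p, q)) (C : 'M[S]_(r, p)) :
  (forall v : 'rV_p, v *m B = 0 -> exists w, v = w *m C) ->
  A *m B = 0 -> exists X, A = X *m C.
Proof.
move=> exC AB0.
have /choice[f Hf] i : exists w, row i A = w *m C.
  by apply: exC; rewrite -row_mul AB0 row0.
exists (\matrix_i f i); apply/row_matrixP => i.
by rewrite row_mul rowK.
Qed.

Hypothesis acD : acyclic_complex.

(** Multiplication by [p] is a chain map over the zero map of the resolved
    module, so it is homotopic to 0. *)
Lemma null_homotopy p : kills_coker p ->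
  exists s : forall i, 'M_(b i, b i.+1),
    p%:M = s 0 *m D 0 /\ forall i, p%:M = s i.+1 *m D i.+1 + D i *m s i.
Proof.
move=> kp; have [D2 exD] := acD.
have [s0 Hs0] : exists s0 : 'M_(b 0, b 1), p%:M = s0 *m D 0.
  have /choice[f Hf] i : exists w, p *: row i 1%:M = w *m D 0 by [].
  exists (\matrix_i f i); apply/row_matrixP => i.
  by rewrite row_mul rowK -Hf; apply/rowP => j; rewrite !mxE mulr_natr.
have step i (s : 'M_(b i, b i.+1)) : D i *m (p%:M - s *m D i) = 0 ->
    exists s', p%:M = s' *m D i.+1 + D i *m s.
  move=> Ds0; have [|s' Hs'] := @row_lift _ _ _ _ (p%:M - D i *m s) (D i) _ (exD i).
    by rewrite mulmxBl -mulmxA -[RHS]Ds0 mulmxBr scalar_mxC.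
  by exists s'; rewrite -Hs' subrK.
(* The condition under which the next homotopy exists. *)
pose good i (s : 'M_(b i, b i.+1)) := D i *m (p%:M - s *m D i) = 0.
have stepT i (s : 'M_(b i, b i.+1)) : good i s ->
    exists s', good i.+1 s' /\ p%:M = s' *m D i.+1 + D i *m s.
  move=> gs; have [s' Hs'] := step i s gs; exists s'; split=> //.
  by rewrite /good Hs' [X in X - _]addrC addrK mulmxA D2 mul0mx.
have good0 : good 0 s0 by rewrite /good Hs0 subrr mulmx0.
have stepX i (x : {s | good i s}) :
    {y : {s | good i.+1 s} | p%:M = sval y *m D i.+1 + D i *m sval x}.
  apply: cid; have [s' [gs' Hs']] := stepT i _ (svalP x).
  by exists (exist _ s' gs').
pose s := fix s i : {s | good i s} :=
  if i is j.+1 then sval (stepX j (s j)) else exist _ s0 good0.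
exists (fun i => sval (s i)); split=> // i /=.
exact: (svalP (stepX i (s i))).
Qed.

Section ScalarBijective.
Variables (N : lmodType S) (p : S).
Hypotheses (kp : kills_coker p) (bij_p : bijective (fun x : N => p *: x)).

(** On cohomology an annihilator of the resolved module acts both as 0, by
    [null_homotopy], and bijectively, since it does so on [N]. The cohomology
    therefore vanishes; this lemma and the next one spell it out in degree 0
    and in positive degrees. *)
Lemma cocyc0_eq0 (u : 'I_(b 0) -> N) : cocyc u -> u = 0.
Proof.
move=> Du; have [s [Hs _]] := null_homotopy kp.
have pu : (fun i => p *: u i) = 0 by rewrite -mxact_scalar Hs mxactM Du mxact0.
apply/funext => i; apply: (bij_inj bij_p).
by rewrite [LHS](congr1 (fun f => f i) pu) scaler0.
Qed.

Lemma cocycS_cobound i (u : 'I_(b i.+1) -> N) : cocyc u -> exists w, u = mxact (D i) w.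
Proof.
move=> Du; have [s [_ Hs]] := null_homotopy kp.
have [g gK Kg] := bij_p.
exists (fun j => g (mxact (s i) u j)).
apply/funext => l; apply: (can_inj gK).
have -> : p *: u l = mxact p%:M u l by rewrite mxact_scalar.
rewrite (Hs i) mxactDl !mxactM Du mxact0 add0r.
rewrite -[RHS]/((fun l => p *: mxact (D i) _ l) l) -mxactZ.
by congr (mxact _ _ l); apply/funext => j; rewrite Kg.
Qed.

End ScalarBijective.

Variable dg : forall i, 'I_(b i) -> int.

(** The component of degree [t] of a cochain, for a basis element of degree
    [dg l] and projections [e] of [N] on its components. *)
Definition cochain_proj (N : lmodType S) (e : int -> N -> N) i t (u : 'I_(b i) -> N) :=
  fun l => e (t + dg l) (u l).

Definition graded_coeff (N : lmodType S) (e : int -> N -> N) : Prop :=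
  (forall t, e t 0 = 0) /\ forall t i (u : 'I_(b i) -> N),
    mxact (D i) (cochain_proj e t u) = cochain_proj e t (mxact (D i) u).

(** An isomorphism [H^j(F, N) = H^i(F, N')] compatible with the gradings, seen
    as a relation between cocycles: connecting maps depend on the choice of
    preimages, and a relation avoids both this choice and the quotients. *)
Record coh_iso (N N' : lmodType S) e e' j i
    (rho : ('I_(b j) -> N) -> ('I_(b i) -> N') -> Prop) : Prop := CohIso {
  coh_iso_cocyc : forall u u', rho u u' -> cocyc u /\ cocyc u';
  coh_iso_total : forall u, cocyc u -> exists u', rho u u';
  coh_iso_surj : forall u', cocyc u' -> exists u, rho u u';
  coh_iso_lin : forall p u v u' v', rho u u' -> rho v v' ->
    rho ((fun l => p *: u l) + v) ((fun l => p *: u' l) + v');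
  coh_iso_cobound : forall u u', rho u u' -> (cobound u <-> cobound u');
  coh_iso_proj : forall t u u', rho u u' ->
    rho (cochain_proj e t u) (cochain_proj e' t u') }.

Lemma coh_iso_refl N e i : graded_coeff e ->
  coh_iso (N := N) (N' := N) e e (fun u u' : 'I_(b i) -> N => cocyc u /\ u = u').
Proof.
move=> [e0 gr_e]; split.
- by move=> u _ [cu <-].
- by move=> u cu; exists u.
- by move=> u cu; exists u.
- move=> p u v _ _ [cu <-] [cv <-]; split=> //.
  by rewrite /cocyc mxactD mxactZ cu cv addr0; apply/funext => l; apply: scaler0.
- by move=> u _ [_ <-].
- move=> t u _ [cu <-]; split=> //; rewrite /cocyc gr_e cu.
  by apply/funext => l; apply: e0.
Qed.

Lemma coh_iso_trans N N' N'' e e' e'' j i l rho rho' :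
  @coh_iso N N' e e' j i rho -> @coh_iso N' N'' e' e'' i l rho' ->
  coh_iso (N := N) (N' := N'') e e'' (fun u w => exists2 v, rho u v & rho' v w).
Proof.
move=> I1 I2; split.
- by move=> u w [v /(coh_iso_cocyc I1)[? _] /(coh_iso_cocyc I2)[_ ?]].
- move=> u /(coh_iso_total I1)[v uv]; have [_ /(coh_iso_total I2)[w vw]] := coh_iso_cocyc I1 uv.
  by exists w, v.
- move=> w /(coh_iso_surj I2)[v vw]; have [/(coh_iso_surj I1)[u uv] _] := coh_iso_cocyc I2 vw.
  by exists u, v.
- move=> p u u' w w' [v uv vw] [v' uv' vw']; exists ((fun l => p *: v l) + v').
    exact: coh_iso_lin I1 _ _ _ _ _ uv uv'.
  exact: coh_iso_lin I2 _ _ _ _ _ vw vw'.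
- by move=> u w [v /(coh_iso_cobound I1)-> /(coh_iso_cobound I2)].
- move=> t u w [v uv vw]; exists (cochain_proj e' t v).
    exact: coh_iso_proj I1 _ _ _ uv.
  exact: coh_iso_proj I2 _ _ _ vw.
Qed.

Section Shift.
Variables (N Q N' : lmodType S) (iota : {linear N -> Q}) (pi : {linear Q -> N'}).
Hypothesis iota_inj : injective iota.
Hypothesis pi_surj : forall x, exists y, pi y = x.
Hypothesis pi_ker : forall y, pi y = 0 <-> exists x, y = iota x.
Variables (e : int -> N -> N) (eQ : int -> Q -> Q) (e' : int -> N' -> N').
Hypothesis iota_e : forall t x, iota (e t x) = eQ t (iota x).
Hypothesis pi_e : forall t x, pi (eQ t x) = e' t (pi x).
Hypothesis gr_Q : graded_coeff eQ.
Variable p : S.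
Hypotheses (kp : kills_coker p) (bij_p : bijective (fun x : Q => p *: x)).

Let pi_iota x : pi (iota x) = 0. Proof. by apply/pi_ker; exists x. Qed.

Lemma cochain_iota q (u : 'I_q -> Q) : pi \o u = 0 -> exists w, u = iota \o w.
Proof.
move=> pu; have /choice[w Hw] l : exists x, u l = iota x.
  by apply/pi_ker; rewrite -[LHS]/((pi \o u) l) pu.
by exists w; apply/funext.
Qed.

Lemma cochain_pi q (u : 'I_q -> N') : exists w, u = pi \o w.
Proof.
have /choice[w Hw] l : exists x, pi x = u l by [].
by exists w; apply/funext => l /=.
Qed.

Lemma iota_comp_inj q (u v : 'I_q -> N) : iota \o u = iota \o v -> u = v.
Proof.
by move=> uv; apply/funext => l; apply: iota_inj; rewrite -[LHS]/((iota \o u) l) uv.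
Qed.

Let piB q (u v : 'I_q -> Q) : pi \o (u - v) = (pi \o u : 'I_q -> N') - (pi \o v : 'I_q -> N').
Proof. by apply/funext => l; apply: raddfB. Qed.

Let pi_iota_comp q (u : 'I_q -> N) : pi \o (iota \o u) = 0.
Proof. by apply/funext => l; apply: pi_iota. Qed.

Definition connecting i (u : 'I_(b i.+1) -> N) (u' : 'I_(b i) -> N') : Prop :=
  cocyc u /\ exists q, iota \o u = mxact (D i) q /\ u' = pi \o q.

(** In the long exact sequence of [0 -> N -> Q -> N' -> 0] the cohomology of [Q]
    vanishes because [p] acts bijectively on [Q]. *)
Lemma connecting_coh_iso i : coh_iso (N := N) (N' := N') e e' (@connecting i).
Proof.
have [DD0 _] := acD; have [eQ0 grQ] := gr_Q.
split.
- move=> u _ [cu [q [Hq ->]]]; split=> //.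
  by rewrite /cocyc mxact_map -Hq pi_iota_comp.
- move=> u cu; have [|q Hq] := cocycS_cobound kp bij_p (u := iota \o u).
    by rewrite /cocyc mxact_map cu; apply/funext => l; apply: raddf0.
  by exists (pi \o q); split=> //; exists q.
- move=> u' cu'; have [q Hq] := cochain_pi u'.
  have [|u Hu] := cochain_iota (u := mxact (D i) q); first by rewrite -mxact_map -Hq.
  exists u; split; last by exists q.
  apply: iota_comp_inj; rewrite -mxact_map -Hu -mxactM DD0.
  apply/funext => l; rewrite /= raddf0 /mxact big1 // => j _.
  by rewrite mxE scale0r.
- move=> c u v _ _ [cu [q [Hq ->]]] [cv [r [Hr ->]]]; split.
    by rewrite /cocyc mxactD mxactZ cu cv addr0; apply/funext => l; apply: scaler0.
  exists ((fun l => c *: q l) + r); split; last first.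
    by apply/funext => l /=; rewrite linearP.
  rewrite mxactD mxactZ -Hq -Hr.
  by apply/funext => l /=; rewrite linearP.
- move=> u _ [cu [q [Hq ->]]]; split.
    move=> [w Hw]; have Dq : mxact (D i) (q - (iota \o w : _ -> Q)) = 0.
      by rewrite mxactB mxact_map -Hq -Hw subrr.
    have eq_pi : pi \o q = pi \o (q - (iota \o w : _ -> Q)) by rewrite piB pi_iota_comp subr0.
    case: i q {u cu Hq} w {Hw} Dq eq_pi => [|i] q w Dq ->.
      rewrite (cocyc0_eq0 kp bij_p Dq) /=.
      by apply/funext => l; apply: raddf0.
    have [z ->] := cocycS_cobound kp bij_p Dq.
    by exists (pi \o z); rewrite mxact_map.
  move=> cob; suff [w Hw] : exists w, mxact (D i) q = mxact (D i) (iota \o w).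
    by exists w; apply: iota_comp_inj; rewrite Hq Hw mxact_map.
  case: i {u cu Hq} q cob => [|i] q /=.
    by move/cochain_iota => [w ->]; exists w.
  move=> [w' Hw']; have [z Hz] := cochain_pi w'.
  have [|w Hw] := cochain_iota (u := q - mxact (D i) z).
    by rewrite piB -mxact_map -Hz -Hw' subrr.
  exists w; rewrite -Hw mxactB -(mxactM _ _ z) DD0.
  by apply/esym; rewrite -[RHS]subr0; congr (_ - _); apply/funext => l;
     rewrite /mxact big1 // => j _; rewrite mxE scale0r.
- move=> t u _ [cu [q [Hq ->]]]; split; last first.
    exists (cochain_proj eQ t q); split; last by apply/funext => l /=; rewrite /cochain_proj /= pi_e.
    by rewrite grQ -Hq; apply/funext => l; rewrite /cochain_proj /= iota_e.
  apply: iota_comp_inj; rewrite -mxact_map.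
  have -> : iota \o cochain_proj e t u = cochain_proj eQ t (iota \o u).
    by apply/funext => l; rewrite /cochain_proj /= iota_e.
  rewrite grQ mxact_map cu; apply/funext => l.
  by rewrite /cochain_proj /= raddf0 eQ0.
Qed.

(** For the same reason [H^0(F, N)], which embeds in [H^0(F, Q)], is 0. *)
Lemma cocyc0_iota (u : 'I_(b 0) -> N) : cocyc u -> u = 0.
Proof.
move=> cu; apply: iota_comp_inj.
rewrite (cocyc0_eq0 kp bij_p (u := iota \o u)).
  by apply/funext => l /=; rewrite raddf0.
by rewrite /cocyc mxact_map cu; apply/funext => l; apply: raddf0.
Qed.

End Shift.

End Complexes.

(** * Modules of functions on sets of exponents *)

Section FunctionModules.
Variables (k : fieldType) (n : nat).
Local Notation S := {mpoly k[n]}.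
Local Notation expo := ('I_n -> int).

Definition mexp (m : 'X_{1..n}) : expo := fun i => (m i)%:Z.

Lemma mexp0 : mexp 0%MM = 0.
Proof. by apply/funext => i; rewrite /mexp mnm0E. Qed.

Lemma mexpD m m' : mexp (m + m')%MM = mexp m + mexp m'.
Proof. by apply/funext => i; rewrite /mexp mnmDE. Qed.

Lemma expoBE (e e' : expo) i : (e - e') i = e i - e' i. Proof. by []. Qed.
Lemma expoDE (e e' : expo) i : (e + e') i = e i + e' i. Proof. by []. Qed.

(** Convexity is what makes truncated shifts compose: if a shifted exponent
    leaves the set and a further shift comes back, a value would be lost. *)
Record convex_set := ConvexSet {
  convex_pred :> pred expo;
  convexP : forall e m m', convex_pred e ->
    convex_pred (e - mexp m - mexp m') -> convex_pred (e - mexp m) }.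

Section LinearForms.

Definition mlin (phi : 'X_{1..n} -> k) (p : S) : k := \sum_(m <- msupp p) p@_m * phi m.

Lemma mlinE phi p d : (msize p <= d)%N ->
  mlin phi p = \sum_(m : 'X_{1..n < d}) p@_m * phi m.
Proof.
move=> le_pd; rewrite /mlin.
pose I : subFinType _ := 'X_{1..n < d}.
rewrite (big_mksub I) ?msupp_uniq //=; last first.
  by move=> m /msize_mdeg_lt /leq_trans; apply.
rewrite big_rmcond //= => m.
by move/memN_msupp_eq0 => ->; rewrite mul0r.
Qed.

Lemma mlin_linear phi c p q : mlin phi (c *: p + q) = c * mlin phi p + mlin phi q.
Proof.
pose d := maxn (msize (c *: p + q)) (maxn (msize p) (msize q)).
rewrite !(@mlinE _ _ d) ?leq_max ?leqnn ?orbT // mulr_sumr -big_split /=.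
by apply: eq_bigr => m _; rewrite mcoeffD mcoeffZ mulrDl mulrA.
Qed.

Lemma mlin0 phi : mlin phi 0 = 0.
Proof. by rewrite /mlin msupp0 big_nil. Qed.

Lemma mlinX phi m : mlin phi 'X_[m] = phi m.
Proof. by rewrite /mlin msuppX big_seq1 mcoeffX eqxx mul1r. Qed.

Lemma mlinD phi psi p c : mlin (fun m => c * phi m + psi m) p = c * mlin phi p + mlin psi p.
Proof.
rewrite /mlin mulr_sumr -big_split /=; apply: eq_bigr => m _.
by rewrite mulrDr mulrCA.
Qed.

Lemma mlin_eq phi psi p : (forall m, m \in msupp p -> phi m = psi m) -> mlin phi p = mlin psi p.
Proof. by move=> e; rewrite /mlin !big_seq; apply: eq_bigr => m /e ->. Qed.

End LinearForms.

(** The exponents in [N^n] give the power series and the negative exponents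
    give the dual of the polynomial ring. In general one gets a subquotient of
    the module of all functions on [Z^n], in which a monomial acts by shifting
    and truncating. *)
Definition fmod (C : convex_set) : Type := {e : expo | C e} -> k.

HB.instance Definition _ C := GRing.Zmodule.copy (fmod C) ({e : expo | C e} -> k).

Section OneSet.
Variable C : convex_set.
Implicit Types (f g : fmod C) (e : expo).

Definition coef f e : k := if insub e is Some x then f x else 0.

Definition mkf (h : expo -> k) : fmod C := fun x => h (val x).

Lemma coef_mkf h e : coef (mkf h) e = if C e then h e else 0.
Proof. by rewrite /coef; case: insubP => [x -> <-|/negPf->]. Qed.

Lemma coef_out f e : ~~ C e -> coef f e = 0.
Proof. by move=> Ce; rewrite /coef insubN. Qed.

Lemma coefP f g : (forall e, C e -> coef f e = coef g e) -> f = g.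
Proof.
move=> fg; apply/funext => x; have := fg (val x) (valP x).
by rewrite /coef valK.
Qed.

Lemma coef0 e : coef 0 e = 0.
Proof. by rewrite /coef; case: insub. Qed.

Lemma coefD f g e : coef (f + g) e = coef f e + coef g e.
Proof. by rewrite /coef; case: insub => // *; rewrite addr0. Qed.

Lemma coefN f e : coef (- f) e = - coef f e.
Proof. by rewrite /coef; case: insub => // *; rewrite oppr0. Qed.

Definition fun_act (p : S) f : fmod C :=
  mkf (fun e => mlin (fun m => coef f (e - mexp m)) p).

Lemma coef_fun_act p f e : coef (fun_act p f) e =
  if C e then mlin (fun m => coef f (e - mexp m)) p else 0.
Proof. exact: coef_mkf. Qed.

Lemma fun_act_linl c p q f e :
  coef (fun_act (c *: p + q) f) e = c * coef (fun_act p f) e + coef (fun_act q f) e.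
Proof. by rewrite !coef_fun_act mlin_linear; case: ifP => // _; rewrite mulr0 addr0. Qed.

Lemma fun_act0l f : fun_act 0 f = 0.
Proof. by apply: coefP => e Ce; rewrite coef_fun_act mlin0 coef0 if_same. Qed.

Lemma fun_actX m f e : coef (fun_act 'X_[m] f) e = if C e then coef f (e - mexp m) else 0.
Proof. by rewrite coef_fun_act mlinX. Qed.

Lemma fun_actDr p f g : fun_act p (f + g) = fun_act p f + fun_act p g.
Proof.
apply: coefP => e Ce; rewrite coefD !coef_fun_act Ce -[mlin (fun m => coef f _) p]mul1r -mlinD.
by apply: mlin_eq => m _; rewrite mul1r coefD.
Qed.

Lemma fun_actDl f p q : fun_act (p + q) f = fun_act p f + fun_act q f.
Proof.
by apply: coefP => e Ce; rewrite coefD -[p]scale1r fun_act_linl mul1r scale1r.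
Qed.

Lemma fun_act1 f : fun_act 1 f = f.
Proof.
by apply: coefP => e Ce; rewrite -mpolyX0 fun_actX Ce mexp0 subr0.
Qed.

Lemma fun_actA p q f : fun_act p (fun_act q f) = fun_act (p * q) f.
Proof.
apply: coefP => e Ce.
elim/mpolyind: p => [|c m p _ _ IH]; first by rewrite mul0r !fun_act0l.
rewrite fun_act_linl mulrDl -scalerAl fun_act_linl IH; congr (_ * _ + _).
rewrite fun_actX Ce {IH p}.
elim/mpolyind: q => [|d m' q _ _ IH]; first by rewrite mulr0 !fun_act0l !coef0.
rewrite fun_act_linl mulrDr -scalerAr fun_act_linl IH -mpolyXD !fun_actX Ce mexpD opprD addrA.
case: ifP => // /negbT Cem; rewrite [coef f _]coef_out //.
by apply: contra Cem => /(convexP Ce).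
Qed.

End OneSet.

HB.instance Definition _ C := GRing.Zmodule_isLmodule.Build S (fmod C)
  (@fun_actA C) (@fun_act1 C) (@fun_actDr C) (@fun_actDl C).

Lemma coefZ C p (f : fmod C) e :
  coef (p *: f) e = if C e then mlin (fun m => coef f (e - mexp m)) p else 0.
Proof. exact: coef_fun_act. Qed.

Lemma coefXZ C m (f : fmod C) e :
  coef ('X_[m] *: f) e = if C e then coef f (e - mexp m) else 0.
Proof. exact: fun_actX. Qed.

Lemma coef_sum C (I : Type) (r : seq I) (F : I -> fmod C) e :
  coef (\sum_(i <- r) F i) e = \sum_(i <- r) coef (F i) e.
Proof. by elim/big_rec2: _ => [|i x y _ <-]; rewrite ?coef0 ?coefD. Qed.

(** This condition covers at once the extension by zero from a subset that is
    closed under addition of monomials, and the restriction to a subset whose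
    complement is. *)
Definition transferable (C C' : pred expo) : Prop :=
  forall e m, C' e -> C (e - mexp m) -> C e = C' (e - mexp m).

Section Transfer.
Variables C C' : convex_set.
Hypothesis tCC' : transferable C C'.

Definition transfer_fun (f : fmod C) : fmod C' := @mkf C' (coef f).

Lemma transfer_is_linear : linear transfer_fun.
Proof.
move=> p f g; apply: coefP => e C'e.
rewrite coefD coefZ !coef_mkf C'e coefD; congr (_ + _).
rewrite coefZ; have [Ce|Ce] := boolP (C e).
  apply: mlin_eq => m _; rewrite coef_mkf.
  have [Cem|Cem] := boolP (C (e - mexp m)); first by rewrite -(tCC' C'e Cem) Ce.
  by rewrite coef_out ?if_same.
apply/esym; rewrite /mlin big1 // => m _; rewrite coef_mkf.
case: ifP => C'em; rewrite ?mulr0 // coef_out ?mulr0 //.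
by apply: contra Ce => Cem; rewrite (tCC' C'e Cem).
Qed.

End Transfer.

Definition transfer (C C' : convex_set) (t : transferable C C') : fmod C -> fmod C' :=
  @transfer_fun C C'.

HB.instance Definition _ (C C' : convex_set) (t : transferable C C') := GRing.isLinear.Build S (fmod C) (fmod C') _
  (@transfer C C' t) (transfer_is_linear t).

Lemma coef_transfer (C C' : convex_set) (t : transferable C C') (f : fmod C) e :
  coef (transfer t f) e = if C' e then coef f e else 0.
Proof. exact: coef_mkf. Qed.

Definition weight (e : expo) : int := \sum_i e i.

Lemma weightB e e' : weight (e - e') = weight e - weight e'.
Proof. by rewrite /weight -sumrB. Qed.

Lemma weight_mexp m : weight (mexp m) = (mdeg m)%:Z.
Proof. by rewrite -[RHS]natz mdegE natr_sum; apply: eq_bigr => i _; rewrite natz. Qed.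

(** Functions may have infinitely many homogeneous components, so the grading is
    recorded by its projections. *)
Definition fproj C (d : int) (f : fmod C) : fmod C :=
  @mkf C (fun e => if weight e == d then coef f e else 0).

Lemma coef_fproj C d (f : fmod C) e :
  coef (fproj d f) e = if weight e == d then coef f e else 0.
Proof. by rewrite coef_mkf; case: ifP => // /negbT Ce; rewrite coef_out ?if_same. Qed.

Lemma fproj0 C d : fproj d (0 : fmod C) = 0.
Proof. by apply: coefP => e Ce; rewrite coef_fproj coef0 if_same. Qed.

Lemma fproj_scale C (f : fmod C) (p : S) s d :
  @mpoly_gr k n s p -> p *: fproj d f = fproj (d + s) (p *: f).
Proof.
move=> hp; apply: coefP => e Ce; rewrite coef_fproj !coefZ Ce.
case: s hp => [s|s] /= hp; last by rewrite hp !mlin0 if_same.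
transitivity (mlin (fun m => if weight e == d + s then coef f (e - mexp m) else 0) p).
  apply: mlin_eq => m /(dhomog_mf hp) deg_m.
  by rewrite coef_fproj weightB weight_mexp deg_m subr_eq.
case: ifP => // _; rewrite /mlin big1 // => m _; exact: mulr0.
Qed.

End FunctionModules.

(** * Sign patterns *)

Section Cones.
Variables (k : fieldType) (n : nat).
Local Notation S := {mpoly k[n]}.
Local Notation expo := ('I_n -> int).
Implicit Types (A B : {set 'I_n}) (e : expo) (i j : 'I_n).

Definition cone_pred B A : pred expo := fun e =>
  [forall j, (j \in A) || (if j \in B then e j < 0 else 0 <= e j)].

Lemma cone_predP B A e :
  reflect (forall j, j \notin A -> if j \in B then e j < 0 else 0 <= e j) (cone_pred B A e).
Proof.
apply: (iffP forallP) => H j; first by move: (H j); case: (j \in A).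
by have := H j; case: (j \in A) => //= ->.
Qed.

Lemma cone_convex B A e (m m' : 'X_{1..n}) : cone_pred B A e ->
  cone_pred B A (e - mexp m - mexp m') -> cone_pred B A (e - mexp m).
Proof.
move=> /cone_predP He /cone_predP Hem; apply/cone_predP => j jA.
by have := He j jA; have := Hem j jA; rewrite !expoBE /mexp; case: ifP => _; lia.
Qed.

Definition cone B A : convex_set n := ConvexSet (@cone_convex B A).

Lemma cone0E B i e : i \notin B ->
  cone B set0 e = cone B [set i] e && (0 <= e i).
Proof.
move=> iB; apply/cone_predP/andP => [H|[/cone_predP H ei] j _].
  split; last by have := H i; rewrite inE (negPf iB) /=; apply.
  by apply/cone_predP => j _; apply: H; rewrite inE.
have [->|ne_ji] := eqVneq j i; first by rewrite (negPf iB).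
by apply: H; rewrite inE.
Qed.

Lemma coneU1E B i e : i \notin B ->
  cone (i |: B) set0 e = cone B [set i] e && (e i < 0).
Proof.
move=> iB; apply/cone_predP/andP => [H|[/cone_predP H ei] j _].
  split; last by have := H i; rewrite !inE eqxx /=; apply.
  apply/cone_predP => j; rewrite inE => ne_ji.
  by have := H j; rewrite !inE (negPf ne_ji) /=; apply.
have [->|ne_ji] := eqVneq j i; first by rewrite setU11.
by rewrite !inE (negPf ne_ji); apply: H; rewrite inE.
Qed.

Lemma transfer_pos B i : i \notin B -> transferable (cone B set0) (cone B [set i]).
Proof.
move=> iB e m He; rewrite !(cone0E _ iB) => /andP[Hem emi].
rewrite He Hem /=; apply/idP.
by move: emi; rewrite expoBE /mexp; lia.
Qed.

Lemma transfer_neg B i : i \notin B -> transferable (cone B [set i]) (cone (i |: B) set0).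
Proof.
move=> iB e m; rewrite !(coneU1E _ iB) => /andP[He ei] Hem.
by rewrite He Hem /=; apply/esym; move: ei; rewrite expoBE /mexp; lia.
Qed.

Section Sequence.
Variables (B : {set 'I_n}) (i : 'I_n) (iB : i \notin B).
Let iota := transfer (k := k) (transfer_pos iB).
Let pi := transfer (k := k) (transfer_neg iB).

Lemma iota_injective : injective iota.
Proof.
move=> f g fg; apply: coefP => e Ce; have /(congr1 (fun h => coef h e)) := fg.
by rewrite !coef_transfer; move: Ce; rewrite (cone0E _ iB) => /andP[-> _].
Qed.

Lemma pi_surjective x : exists y, pi y = x.
Proof.
exists (@mkf k n (cone B [set i]) (coef x)); apply: coefP => e Ce.
rewrite coef_transfer Ce coef_mkf.
by move: Ce; rewrite (coneU1E _ iB) => /andP[-> _].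
Qed.

Lemma pi_kernel y : pi y = 0 <-> exists x, y = iota x.
Proof.
split=> [pi0|[x ->]].
  exists (@mkf k n (cone B set0) (coef y)); apply: coefP => e Ce.
  rewrite coef_transfer Ce coef_mkf (cone0E _ iB) Ce /=; case: ifP => // /negbT ei.
  have := congr1 (fun h => coef h e) pi0.
  by rewrite coef_transfer coef0 (coneU1E _ iB) Ce ltNge ei.
apply: coefP => e Ce; rewrite coef0 !coef_transfer Ce.
move: Ce; rewrite (coneU1E _ iB) => /andP[-> ei].
by rewrite coef_out // (cone0E _ iB) negb_and -ltNge ei orbT.
Qed.

Lemma iota_fproj d x : iota (fproj d x) = fproj d (iota x).
Proof.
apply: coefP => e Ce; rewrite !coef_fproj !coef_transfer Ce coef_fproj.
by [].
Qed.

Lemma pi_fproj d x : pi (fproj d x) = fproj d (pi x).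
Proof.
by apply: coefP => e Ce; rewrite !coef_fproj !coef_transfer Ce coef_fproj.
Qed.

End Sequence.

Section Contraction.
Variables (C : convex_set n) (i0 : 'I_n) (T : fmod k C -> fmod k C).
Hypothesis C_ge0 : forall e, C e -> 0 <= e i0.
Hypothesis TB : forall f g, T (f - g) = T f - T g.

Definition vanish_below (m : nat) (f : fmod k C) : Prop :=
  forall e, e i0 < m%:Z -> coef f e = 0.

Hypothesis T_contract : forall m f, vanish_below m f -> vanish_below m.+1 (T f).

Lemma vanish_below0 f : vanish_below 0 f.
Proof.
move=> e e0; apply: coef_out; apply/negP => /C_ge0.
by rewrite leNgt e0.
Qed.

(** The operator [T] raises the exponent of coordinate [i0], which is bounded
    below, so [1 - T] is injective, and it is surjective because the partial
    sums of [g + T g + T (T g) + ...] stabilize at each exponent. *)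
Lemma contraction_fix0 f : f = T f -> f = 0.
Proof.
move=> fTf; have van m : vanish_below m f.
  by elim: m => [|m IH]; [apply: vanish_below0 | rewrite fTf; apply: T_contract].
apply: coefP => e Ce; rewrite coef0; apply: (van (`|e i0|.+1)%N).
by have := C_ge0 Ce; lia.
Qed.

Lemma contraction_solve g : exists f, f = g + T f.
Proof.
pose F m := iter m (fun f => g + T f) 0.
have FS m : F m.+1 = g + T (F m) by [].
have F_step m : vanish_below m (F m.+1 - F m).
  elim: m => [|m IH]; first exact: vanish_below0.
  rewrite !FS opprD addrACA subrr add0r -TB -FS.
  exact: T_contract.
have F_diff m p : vanish_below m (F (m + p)%N - F m).
  elim: p => [|p IH] e em; first by rewrite addn0 subrr coef0.
  rewrite addnS -[F _.+1](subrK (F (m + p)%N)) -addrA coefD IH //.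
  rewrite addr0; apply: (F_step (m + p)%N).
  by apply: lt_le_trans em _; rewrite lez_nat leq_addr.
(* The iterates are constant at [e] from index [e i0 + 1] on. *)
pose f := @mkf k n C (fun e => coef (F (`|e i0|.+1)%N) e).
have f_diff m : vanish_below m (f - F m).
  move=> e em; have [Ce|Ce] := boolP (C e); last by rewrite coef_out.
  have e_ge0 := C_ge0 Ce.
  rewrite coefD coefN coef_mkf Ce.
  have [p ->] : exists p, m = (`|e i0|.+1 + p)%N.
    by exists (m - `|e i0|.+1)%N; lia.
  apply/eqP; rewrite -opprB oppr_eq0 -coefN -coefD; apply/eqP.
  by apply: F_diff; lia.
exists f; apply: coefP => e Ce; have e_ge0 := C_ge0 Ce.
have := f_diff (`|e i0|)%N; move/T_contract/(_ e); rewrite TB coefD coefN => Tf.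
rewrite coefD; have -> : coef (T f) e = coef (T (F `|e i0|%N)) e.
  by apply/eqP; rewrite -subr_eq0 Tf //; lia.
by rewrite -coefD -FS coef_mkf Ce.
Qed.

End Contraction.

Lemma inj_surj_bij (X Y : Type) (f : X -> Y) :
  injective f -> (forall y, exists x, f x = y) -> bijective f.
Proof.
move=> f_inj /choice[g Hg]; exists g => // x.
by apply: f_inj.
Qed.

(** Where the exponent of [X_i] is arbitrary, [X_i ^ N] is invertible; dividing
    by it leaves [1 - T], where [T] is divisible by [X_i0] and hence
    contracting. *)
Lemma monic_bijective B i i0 N (h : S) : i != i0 -> i0 \notin B ->
  bijective (fun f : fmod k (cone B [set i]) => ('X_i ^+ N - 'X_i0 * h) *: f).
Proof.
move=> ne_i i0B; set C := cone B [set i].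
have C_ge0 e : C e -> 0 <= e i0.
  by move=> /cone_predP/(_ i0); rewrite inE eq_sym ne_i (negPf i0B) /=; apply.
pose M := (U_(i) *+ N)%MM.
have M_i0 : M i0 = 0%N by rewrite /M mulmnE mnm1E (negPf ne_i).
have CM e : C (e + mexp M) = C e.
  apply/cone_predP/cone_predP => H j jA; have := H j jA; move: jA; rewrite inE => ne_ji;
    by rewrite expoDE /mexp /M mulmnE mnm1E eq_sym (negPf ne_ji) mul0n addr0.
pose tau (g : fmod k C) : fmod k C := @mkf k n C (fun e => coef g (e + mexp M)).
have tauD f g : tau (f + g) = tau f + tau g.
  by apply: coefP => e Ce; rewrite coefD !coef_mkf Ce coefD.
have tauN f : tau (- f) = - tau f.
  by apply: coefP => e Ce; rewrite coefN !coef_mkf Ce coefN.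
have tau0 : tau 0 = 0 by apply: coefP => e Ce; rewrite coef_mkf Ce !coef0.
have CMB e : C (e - mexp M) = C e by rewrite -CM subrK.
have tauK g : 'X_[M] *: tau g = g.
  by apply: coefP => e Ce; rewrite coefXZ Ce coef_mkf CMB Ce subrK.
have Ktau g : tau ('X_[M] *: g) = g.
  by apply: coefP => e Ce; rewrite coef_mkf Ce coefXZ CM Ce addrK.
pose T f := tau (('X_i0 * h) *: f).
have TB f g : T (f - g) = T f - T g by rewrite /T scalerBr tauD tauN.
have T_contract m f : vanish_below i0 m f -> vanish_below i0 m.+1 (T f).
  move=> van e em; rewrite coef_mkf; case: ifP => // Ce.
  rewrite -scalerA coefXZ CM Ce coefZ; case: ifP => // _.
  rewrite /mlin big1 // => m' _; rewrite van ?mulr0 // !expoBE expoDE /mexp M_i0 mnm1E eqxx.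
  by lia.
have solveE f g : ('X_i ^+ N - 'X_i0 * h) *: f = g <-> f = tau g + T f.
  rewrite mpolyXn -/M scalerBl; split=> [<-|fE]; first by rewrite tauD tauN Ktau subrK.
  by rewrite {1}fE scalerDr !tauK addrK.
apply: inj_surj_bij => [f g fg|g].
  apply/eqP; rewrite -subr_eq0; apply/eqP; apply: (contraction_fix0 C_ge0 T_contract).
  have /solveE {1}-> : ('X_i ^+ N - 'X_i0 * h) *: (f - g) = 0 by rewrite scalerBr fg subrr.
  by rewrite tau0 add0r.
by have [f /solveE Hf] := contraction_solve C_ge0 TB T_contract (tau g); exists f.
Qed.

End Cones.

(** * Functions on the last cone as functionals *)

Section Residues.
Variables (k : fieldType) (n : nat) (i0 : 'I_n).
Local Notation S := {mpoly k[n]}.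
Local Notation expo := ('I_n -> int).

Definition last_cone : convex_set n := cone (~: [set i0]) set0.
Local Notation L := (fmod k last_cone).

Lemma last_coneP (e : expo) :
  last_cone e <-> 0 <= e i0 /\ forall j, j != i0 -> e j < 0.
Proof.
split=> [/cone_predP H|[e0 ej]].
  split=> [|j ne_j]; first by have := H i0; rewrite !inE eqxx /=; apply.
  by have := H j; rewrite !inE ne_j; apply.
apply/cone_predP => j _; rewrite !inE; case: eqVneq => [->|/ej] //=.
Qed.

Definition line_expo (m : nat) : expo := fun j => if j == i0 then m%:Z else -1.

Lemma line_expo_cone m : last_cone (line_expo m).
Proof.
apply/last_coneP; rewrite /line_expo eqxx; split=> // j /negPf ->.
by [].
Qed.

Lemma weight_line m : weight (line_expo m) = m%:Z - (n.-1)%:Z.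
Proof.
rewrite /weight (bigD1 i0) //= /line_expo eqxx; congr (_ + _).
rewrite (eq_bigr (fun=> -1)) => [|j /negPf -> //].
by rewrite sumr_const cardC1 card_ord mulNrn natz.
Qed.

(** The coefficient function along the line of exponents equal to [-1] outside
    [i0]: the residue with respect to the other variables, as a series in
    ['X_i0]. *)
Definition res (m : nat) (f : L) : k := coef f (line_expo m).

Lemma resD m f g : res m (f + g) = res m f + res m g.
Proof. exact: coefD. Qed.

Lemma resN m f : res m (- f) = - res m f.
Proof. exact: coefN. Qed.

Lemma res0 m : res m 0 = 0. Proof. exact: coef0. Qed.

Lemma resC m c f : res m (c%:MP *: f) = c * res m f.
Proof.
rewrite /res coefZ line_expo_cone -[c%:MP]addr0 -alg_mpolyC mlin_linear mlin0 addr0.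
by rewrite -mpolyX0 mlinX mexp0 subr0.
Qed.

Lemma res_shift m f : res m.+1 ('X_i0 *: f) = res m f.
Proof.
rewrite /res coefXZ line_expo_cone; congr coef; apply/funext => j.
rewrite expoBE /mexp /line_expo mnm1E eq_sym; case: eqVneq => _ //=; lia.
Qed.

Lemma res_shift0 f : res 0 ('X_i0 *: f) = 0.
Proof.
rewrite /res coefXZ line_expo_cone coef_out //; apply/negP => /last_coneP[].
by rewrite expoBE /mexp /line_expo eqxx mnm1E eqxx.
Qed.

Definition line_offset (e : expo) : 'X_{1..n} :=
  [multinom if j == i0 then 0%N else absz (e j + 1)%R | j < n].

Lemma line_offsetK (e : expo) : last_cone e ->
  line_expo `|e i0| - mexp (line_offset e) = e.
Proof.
move=> /last_coneP[e0 ej]; apply/funext => j.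
rewrite expoBE /mexp /line_expo mnmE; case: eqVneq => [->|/ej]; lia.
Qed.

Lemma res_offset (f : L) e : last_cone e ->
  coef f e = res `|e i0| ('X_[line_offset e] *: f).
Proof. by move=> Ce; rewrite /res coefXZ line_expo_cone line_offsetK. Qed.

(** The family of functionals [W m] is one functional with values in the power
    series [sum_m W m * 'X_i0 ^ m], linear over the polynomials in ['X_i0]. *)
Definition series_functional q (W : nat -> 'rV[S]_q -> k) : Prop :=
  [/\ forall m c v w, W m (c%:MP *: v + w) = c * W m v + W m w,
      forall v, W 0 ('X_i0 *: v) = 0
    & forall m v, W m.+1 ('X_i0 *: v) = W m v].

Definition pairing q (v : 'rV[S]_q) (u : 'I_q -> L) : L := mxact v u 0.

Lemma pairingM p q (v : 'rV[S]_p) (A : 'M_(p, q)) (u : 'I_q -> L) :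
  pairing (v *m A) u = pairing v (mxact A u).
Proof. by rewrite /pairing mxactM. Qed.

Lemma pairingZ q p (v : 'rV[S]_q) u : pairing (p *: v) u = p *: pairing v u.
Proof.
rewrite /pairing /mxact scaler_sumr; apply: eq_bigr => j _.
by rewrite mxE scalerA.
Qed.

Lemma pairingDl q (v w : 'rV[S]_q) u : pairing (v + w) u = pairing v u + pairing w u.
Proof. by rewrite /pairing mxactDl. Qed.

Lemma pairing_delta q l (u : 'I_q -> L) p : pairing (p *: delta_mx 0 l) u = p *: u l.
Proof.
rewrite pairingZ /pairing /mxact (bigD1 l) //= big1 ?addr0 => [|j ne_jl].
  by rewrite mxE !eqxx scale1r.
by rewrite mxE (negPf ne_jl) andbF scale0r.
Qed.

Lemma res_pairing_series q (u : 'I_q -> L) :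
  series_functional (fun m v => res m (pairing v u)).
Proof.
split=> [m c v w|v|m v]; rewrite ?pairingDl ?pairingZ.
- by rewrite resD resC.
- exact: res_shift0.
- exact: res_shift.
Qed.

(** Every value of a function is a residue of one of its multiples. *)
Lemma res_pairing_eq0 q (u : 'I_q -> L) :
  (forall m v, res m (pairing v u) = 0) -> u = 0.
Proof.
move=> u0; apply/funext => l; apply: coefP => e Ce.
by rewrite res_offset // -pairing_delta u0 coef0.
Qed.

Section Representation.
Variables (q : nat) (W : nat -> 'rV[S]_q -> k).
Hypothesis serW : series_functional W.

Let WD m v w : W m (v + w) = W m v + W m w.
Proof.
by have [linW _ _] := serW; rewrite -[v]scale1r -mpolyC1 linW mul1r mpolyC1 scale1r.
Qed.

Let W0 m : W m 0 = 0.
Proof. by apply: (addrI (W m 0)); rewrite -WD !addr0. Qed.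

Let W_poly m p l :
  W m (p *: delta_mx 0 l) = mlin (fun mu => W m ('X_[mu] *: delta_mx 0 l)) p.
Proof.
elim/mpolyind: p => [|c mu p _ _ IH]; first by rewrite scale0r W0 mlin0.
rewrite mlin_linear mlinX -IH scalerDl -mul_mpolyC -scalerA.
by have [linW _ _] := serW; rewrite linW.
Qed.

Let W_shift m (a : nat) v :
  W m ('X_i0 ^+ a *: v) = if (a <= m)%N then W (m - a) v else 0.
Proof.
have [_ W_0 W_S] := serW.
elim: a m => [|a IH] m; first by rewrite expr0 scale1r subn0.
rewrite exprS -scalerA; case: m => [|m]; first by rewrite W_0.
by rewrite W_S IH ltnS subSS.
Qed.

(** The value at [e] of a representing function has to be the value of the
    functional on the monomial that moves [e] to the line of [res]. *)
Lemma series_functional_representable :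
  exists u : 'I_q -> L, forall m v, res m (pairing v u) = W m v.
Proof.
exists (fun l => @mkf k n last_cone
  (fun e => W `|e i0|%N ('X_[line_offset e] *: delta_mx 0 l))) => m v.
have -> : W m v = \sum_l W m (v 0 l *: delta_mx 0 l).
  rewrite [in LHS](row_sum_delta v); exact: (big_morph _ (WD m) (W0 m)).
rewrite /res /pairing /mxact coef_sum; apply: eq_bigr => l _.
rewrite W_poly coefZ line_expo_cone; apply: mlin_eq => mu _.
pose mu' : 'X_{1..n} := [multinom if j == i0 then 0%N else mu j | j < n].
have -> : 'X_[mu] = 'X_i0 ^+ (mu i0) * 'X_[mu'] :> S.
  rewrite mpolyXn -mpolyXD; congr 'X_[_]; apply/mnmP => j.
  rewrite mnmDE mulmnE mnm1E mnmE eq_sym; case: eqVneq => [->|_]; lia.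
rewrite -scalerA W_shift coef_mkf.
have -> : last_cone (line_expo m - mexp mu) = (mu i0 <= m)%N.
  apply/idP/idP => [/last_coneP[]|le_mu]; last apply/last_coneP.
    by rewrite expoBE /mexp /line_expo eqxx; lia.
  by split=> [|j /negPf ne_j]; rewrite expoBE /mexp /line_expo ?eqxx ?ne_j; lia.
case: ifP => // le_mu; congr (W _ ('X_[_] *: _)).
  by rewrite expoBE /mexp /line_expo eqxx; lia.
apply/mnmP => j; rewrite !mnmE expoBE /mexp /line_expo; case: eqVneq => // _.
by lia.
Qed.

End Representation.
End Residues.

(** * Cohomology with coefficients in functions *)

Section CohomologyOfResolution.
Variables (k : fieldType) (n : nat) (i0 : 'I_n) (R : comNzRingType).
Local Notation S := {mpoly k[n]}.
Variables (ev : {rmorphism S -> R}) (b : nat -> nat).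
Variables (D : forall i, 'M[S]_(b i.+1, b i)) (aug : 'I_(b 0) -> R).
Variable dg : forall i, 'I_(b i) -> int.

Definition augment (v : 'rV[S]_(b 0)) : R := \sum_l ev (v 0 l) * aug l.

Definition resolution : Prop :=
  [/\ forall r, exists v, augment v = r,
      forall v, augment v = 0 <-> exists w, v = w *m D 0
    & forall i (v : 'rV_(b i.+1)), v *m D i = 0 <-> exists w, v = w *m D i.+1].

Hypothesis F_res : resolution.
Hypothesis homD : forall i j l, @mpoly_gr k n (dg j - dg l) (D i j l).
Hypothesis y_reg : forall r, ev 'X_i0 * r = 0 -> r = 0.
Hypothesis y_par : forall i, i != i0 ->
  exists N h, ev ('X_i ^+ N - 'X_i0 * h) = 0.

Lemma augmentD v w : augment (v + w) = augment v + augment w.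
Proof.
by rewrite -big_split /=; apply: eq_bigr => l _; rewrite mxE rmorphD mulrDl.
Qed.

Lemma augmentZ p v : augment (p *: v) = ev p * augment v.
Proof.
by rewrite mulr_sumr; apply: eq_bigr => l _; rewrite mxE rmorphM mulrA.
Qed.

Lemma resolution_acyclic : acyclic_complex D.
Proof.
have [_ _ ex] := F_res; split=> [i|i v /ex //].
apply/row_matrixP => j; rewrite row0 row_mul; apply/ex.
by exists (row j 1%:M); rewrite -row_mul mul1mx.
Qed.

Lemma resolution_kills p : ev p = 0 -> kills_coker D p.
Proof.
by move=> ep v; have [_ ex _] := F_res; apply/ex; rewrite augmentZ ep mul0r.
Qed.

Lemma fproj_graded C : graded_coeff D dg (@fproj k n C).
Proof.
split=> [t|t i u]; first exact: fproj0.
apply/funext => j; rewrite /mxact /cochain_proj.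
have -> : fproj (t + dg j) (\sum_l D i j l *: u l) =
    \sum_l fproj (t + dg j) (D i j l *: u l).
  apply: coefP => e Ce; rewrite coef_fproj !coef_sum; case: ifP => We.
    by apply: eq_bigr => l _; rewrite coef_fproj We.
  by rewrite big1 // => l _; rewrite coef_fproj We.
apply: eq_bigr => l _; rewrite (fproj_scale _ _ (homD j l)).
by congr fproj; ring.
Qed.

(** One connecting isomorphism for each coordinate made negative. *)
Lemma cone_cohomology_iso (m : nat) (B : {set 'I_n}) : #|B| = m -> i0 \notin B ->
  forall i j, j = (i + m)%N ->
  exists rho, @coh_iso _ b D dg (fmod k (cone set0 set0)) (fmod k (cone B set0))
    (@fproj k n _) (@fproj k n _) j i rho.
Proof.
elim: m B => [|m IH] B cardB i0B i j ->.
  have -> : B = set0 by apply/eqP; rewrite -cards_eq0 cardB.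
  rewrite addn0; exists (fun u u' => cocyc D u /\ u = u').
  exact/coh_iso_refl/fproj_graded.
have [i1 i1B] : exists i1, i1 \in B by apply/set0Pn; rewrite -cards_eq0 cardB.
pose B' := B :\ i1; have i1B' : i1 \notin B' by rewrite !inE eqxx.
have BE : B = i1 |: B' by rewrite setD1K.
have ne_i1 : i1 != i0 by apply: contraNneq i0B => <-.
have i0B' : i0 \notin B' by rewrite !inE (negPf i0B) andbF.
have cardB' : #|B'| = m by apply/eqP; rewrite -eqSS -cardB BE cardsU1 i1B'.
have [rho Hrho] := IH B' cardB' i0B' i.+1 (i + m.+1)%N (esym (addSnnS _ _)).
have [N [h Hp]] := y_par ne_i1.
have kp := resolution_kills Hp.
rewrite BE; eexists; apply: (coh_iso_trans Hrho).
exact: (connecting_coh_iso resolution_acyclic (@iota_injective k n B' i1 i1B')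
  (@pi_surjective k n B' i1 i1B') (@pi_kernel k n B' i1 i1B')
  (@iota_fproj k n B' i1 i1B') (@pi_fproj k n B' i1 i1B')
  (@fproj_graded _) kp (monic_bijective N h ne_i1 i0B')).
Qed.

(** Make [g] coordinates negative, leaving one more besides [i0]: the class
    moves to degree 0, where the sequence for this coordinate embeds it in a
    vanishing group. *)
Lemma low_cohomology_vanishes g (u : 'I_(b g) -> fmod k (cone set0 set0)) :
  (g < n.-1)%N -> cocyc D u -> cobound D u.
Proof.
move=> lt_g cu.
have [B i0B cardB] : exists2 B : {set 'I_n}, i0 \notin B & #|B| = g.
  have : (g <= #|~: [set i0]|)%N by rewrite cardsC1 card_ord ltnW.
  move/card_geqP => [s [s_uniq s_size s_sub]].
  exists [set i in s]; last by rewrite cardsE (card_uniqP s_uniq).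
  by rewrite inE; apply/negP => /s_sub; rewrite !inE eqxx.
have [i1 i1B] : exists i1, i1 \in ~: (i0 |: B).
  apply/set0Pn; rewrite -cards_eq0 cardsCs setCK cardsU1 i0B cardB card_ord.
  by lia.
move: i1B; rewrite !inE negb_or => /andP[ne_i1 i1B].
have [rho Hrho] := @cone_cohomology_iso g B cardB i0B 0 g erefl.
have [u' uu'] := coh_iso_total Hrho cu.
apply/(coh_iso_cobound Hrho uu').
have [_ cu'] := coh_iso_cocyc Hrho uu'.
have [N [h Hp]] := y_par ne_i1.
exact: (cocyc0_iota resolution_acyclic (@iota_injective k n B i1 i1B)
  (resolution_kills Hp) (monic_bijective N h ne_i1 i0B) cu').
Qed.

Local Notation L := (fmod k (last_cone i0)).

(** Regularity of the parameter on [R], and on [S], transferred to the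
    resolution: the reduction of the resolution modulo ['X_i0] stays exact. *)
Lemma y_divides_boundary i (q : 'rV[S]_(b i)) v :
  'X_i0 *: q = v *m D i -> exists q', q = q' *m D i.
Proof.
have [_ ex0 exS] := F_res.
case: i q v => [|i] q v qv.
  by apply/ex0; apply: y_reg; rewrite -augmentZ; apply/ex0; exists v.
apply/exS; have [DD _] := resolution_acyclic.
have : 'X_i0 *: (q *m D i) = 0 by rewrite scalemxAl qv -mulmxA DD mulmx0.
move/rowP => XqD; apply/rowP => j; move/eqP: (XqD j); rewrite !mxE mulf_eq0 => /orP[|/eqP->//].
by rewrite -msize_poly_eq0 msizeX.
Qed.

(** One more coefficient of a series functional with prescribed boundary [U]: its
    values on boundaries and on multiples of ['X_i0] are imposed, and they are
    compatible by [y_divides_boundary]. *)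
Lemma boundary_extension i (U U_ : 'rV[S]_(b i.+1) -> k) (W_ : 'rV[S]_(b i) -> k) :
  (forall c v w, U (c%:MP *: v + w) = c * U v + U w) ->
  (forall z, U (z *m D i.+1) = 0) ->
  (forall v, U ('X_i0 *: v) = U_ v) ->
  (forall c v w, W_ (c%:MP *: v + w) = c * W_ v + W_ w) ->
  (forall v, W_ (v *m D i) = U_ v) ->
  exists W : 'rV[S]_(b i) -> k,
    [/\ forall c v w, W (c%:MP *: v + w) = c * W v + W w,
        forall v, W (v *m D i) = U v & forall v, W ('X_i0 *: v) = W_ v].
Proof.
move=> linU UD UX linW W_D; have [DD exD] := resolution_acyclic.
have linD (T : 'rV[S]_(b i.+1) -> k) : (forall c v w, T (c%:MP *: v + w) = c * T v + T w) ->
    forall v w, T (v + w) = T v + T w.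
  by move=> linT v w; rewrite -[v]scale1r -mpolyC1 linT mul1r mpolyC1 scale1r.
have U0 : U 0 = 0 by rewrite -(mul0mx _ (D i.+1)) UD.
have W0 : W_ 0 = 0.
  by have := linW (-1) 0 0; rewrite scaler0 addr0 mulN1r addNr.
(* Plain families are used instead of rows, which are not a [k]-module. *)
pose A (f : 'I_(b i) -> S) d :=
  exists v q, \row_l f l = v *m D i + 'X_i0 *: q /\ d = U v + W_ q.
have [|lam [linlam Alam]] := @linear_functional_extension k _ A.
  split; first split.
  - exists 0, 0; rewrite mul0mx scaler0 U0 W0 !addr0; split=> //.
    by apply/rowP => l; rewrite !mxE.
  - move=> c f f' d d' [v [q [Hf ->]]] [v' [q' [Hf' ->]]].
    exists (c%:MP *: v + v'), (c%:MP *: q + q'); split; last by rewrite linU linW mulrDr addrACA.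
    have -> : \row_l (c *: f + f') l = c%:MP *: \row_l f l + \row_l f' l.
      by apply/rowP => l; rewrite !mxE mul_mpolyC.
    rewrite Hf Hf' mulmxDl -scalemxAl !scalerDr !scalerA [in RHS]mulrC.
    by rewrite addrACA.
  - move=> d [v [q [Hf ->]]].
    have Xq : 'X_i0 *: q = (- v) *m D i.
      apply/eqP; rewrite mulNmx -subr_eq0 opprK addrC -Hf; apply/eqP.
      by apply/rowP => l; rewrite !mxE.
    have [q' qE] := y_divides_boundary Xq.
    have [|z zE] := exD i (v + 'X_i0 *: q').
      by rewrite mulmxDl -scalemxAl -qE Xq mulNmx subrr.
    by rewrite qE W_D -UX -(linD _ linU) zE UD.
exists (fun v => lam (fun l => v 0 l)); split.
- move=> c v w; rewrite -linlam; congr lam; apply/funext => l.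
  by rewrite !mxE mul_mpolyC.
- move=> v; apply: Alam; exists v, 0; rewrite W0 scaler0 !addr0; split=> //.
  by apply/rowP => l; rewrite mxE.
- move=> v; apply: Alam; exists 0, v; rewrite U0 mul0mx !add0r; split=> //.
  by apply/rowP => l; rewrite mxE.
Qed.

(** A cocycle is a series functional that vanishes on boundaries; it is extended
    along the differential one coefficient at a time. *)
Lemma last_cone_cohomology_vanishes i (u : 'I_(b i.+1) -> L) :
  cocyc D u -> exists w, u = mxact (D i) w.
Proof.
move=> cu; have [linU UX0 UXS] := res_pairing_series u.
pose U m v := res m (pairing v u).
pose good m (W : 'rV[S]_(b i) -> k) :=
  (forall c v w, W (c%:MP *: v + w) = c * W v + W w) /\ forall v, W (v *m D i) = U m v.
have UD m z : U m (z *m D i.+1) = 0.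
  by rewrite /U pairingM cu /pairing mxact0 res0.
have [W0 [gW0 W0X]] : exists W0, good 0 W0 /\ forall v, W0 ('X_i0 *: v) = 0.
  have [||||| W [? ? ?]] := @boundary_extension i (U 0) (fun=> 0) (fun=> 0) => //.
  - exact: linU.
  - by move=> *; rewrite mulr0 addr0.
  by exists W.
(* Coefficient [m + 1] is constructed from coefficient [m]. *)
have step m (W : {W | good m W}) :
    {W' : {W | good m.+1 W} | forall v, sval W' ('X_i0 *: v) = sval W v}.
  apply: cid; case: W => W [linW WD].
  have [||||| W' [linW' WD' W'X]] := @boundary_extension i (U m.+1) (U m) W => //.
  - exact: linU.
  - exact: UXS.
  by exists (exist _ W' (conj linW' WD')).
pose W := fix W m : {W | good m W} :=
  if m is m'.+1 then sval (step m' (W m')) else exist _ W0 gW0.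
have [|w Hw] := @series_functional_representable k n i0 _ (fun m => sval (W m)).
  split=> [m c v v'|//|m v]; first by have [linW _] := svalP (W m); apply: linW.
  exact: (svalP (step m (W m))).
exists w; apply/eqP; rewrite -subr_eq0; apply/eqP; apply: res_pairing_eq0 => m v.
have -> : pairing v (u - mxact (D i) w) = pairing v u - pairing (v *m D i) w.
  by rewrite pairingM /pairing mxactB.
have [_ WD] := svalP (W m).
by rewrite resD resN Hw WD subrr.
Qed.

End CohomologyOfResolution.

(** * Gradings *)

Section Gradings.

Lemma grading_component (T : eqType) (V : zmodType) (G : T -> V -> Prop) (s : seq T) f j v :
  grading G -> uniq s -> j \in s -> (forall i, G i (f i)) ->
  v = \sum_(i <- s) f i -> G j v -> f j = v.
Proof.
move=> [G_sub _ G_uniq] s_uniq js Gf vE Gv.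
apply/eqP; rewrite -subr_eq0; apply/eqP.
pose f' i := if i == j then f j - v else f i.
have <- : f' j = f j - v by rewrite /f' eqxx.
apply: (G_uniq s f' s_uniq _ _ j js).
  move=> i; rewrite /f'; case: eqP => [->|_] //.
  by have [_] := G_sub j; apply.
rewrite (bigD1_seq j) //= /f' eqxx addrAC.
rewrite (eq_bigr f) => [|i /negPf->//].
by rewrite -(bigD1_seq j) //= -vE subrr.
Qed.

(** A grading by [nat] extended by zero in negative degrees, so that it can be
    shifted freely. *)
Lemma grading_zgr (V : zmodType) (G : nat -> V -> Prop) : grading G -> grading (zgr G).
Proof.
move=> [G_sub G_ex G_uniq]; split.
- case=> i /=; first exact: G_sub.
  by split=> // u v -> ->; rewrite subrr.
- move=> v; have [s [f [Gf ->]]] := G_ex v.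
  exists (map Posz s), (fun i => if i is Posz m then f m else 0); split; last by rewrite big_map.
  by case.
- move=> s f s_uniq Gf sum0.
  have f_neg m : f (Negz m) = 0 by exact: Gf (Negz m).
  pose s' := pmap (fun i => if i is Posz m then Some m else None) s.
  have s'P m : (m \in s') = (Posz m \in s).
    rewrite /s'; elim: s {s_uniq sum0 s'} => // -[x|x] s IH /=; rewrite !inE ?IH //.
  have s'_uniq : uniq s'.
    by apply: (pmap_uniq (g := Posz)) s_uniq => -[].
  have sum0' : \sum_(m <- s') f (Posz m) = 0.
    transitivity (\sum_(i <- s) f i); last exact: sum0.
    rewrite /s'; elim: s {s_uniq sum0 s' s'P s'_uniq} => [|[x|x] s IH] /=.
    + by rewrite !big_nil.
    + by rewrite !big_cons IH.
    + by rewrite big_cons f_neg add0r.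
  case=> i is_; last exact: f_neg.
  by apply: (G_uniq s' (f \o Posz)) => //; [move=> m; apply: (Gf (Posz m)) | rewrite s'P].
Qed.

End Gradings.

Section PolynomialComponents.
Variables (k : fieldType) (n : nat).
Local Notation S := {mpoly k[n]}.

Definition pcomp (d : int) (p : S) : S :=
  if d is Posz m then pihomog mdeg m p else 0.

Lemma mcoeff_pcomp d (p : S) m :
  (pcomp d p)@_m = if (mdeg m)%:Z == d then p@_m else 0.
Proof.
case: d => [d|d] /=; last by rewrite mcoeff0.
elim/mpolyind: p => [|c m' p _ _ IH]; first by rewrite pihomog0 mcoeff0 if_same.
rewrite pihomogD linearZ /= !mcoeffD IH !mcoeffZ pihomogX.
have [->|ne_m] := eqVneq m' m.
  rewrite [(mdeg m)%:Z == _](_ : _ = (mdeg m == d)) //.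
  by case: eqP => _; rewrite ?mcoeff0 // mulr0 addr0.
have X0 : 'X_[m']@_m = 0 :> k by rewrite mcoeffX (negPf ne_m).
by case: ifP => _; case: ifP => _; rewrite ?X0 ?mcoeff0 ?mulr0 ?add0r.
Qed.

Lemma pcomp_gr d (p : S) : mpoly_gr d (pcomp d p).
Proof. by case: d => //= d; apply: pihomogP. Qed.

Lemma mpoly_grP d (p : S) :
  mpoly_gr d p <-> forall m, p@_m != 0 -> (mdeg m)%:Z = d.
Proof.
case: d => d /=; split.
- by move=> hp m; rewrite -mcoeff_msupp => /(dhomog_mf hp) ->.
- by move=> hp; apply/dhomogP => m; rewrite mcoeff_msupp => /hp [].
- by move=> -> m; rewrite mcoeff0 eqxx.
- move=> hp; apply/mpolyP => m; rewrite mcoeff0; apply/eqP/negPn/negP.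
  by move/hp.
Qed.

(** The shifts [sh] stand for the degrees of basis elements. The degree [t] is
    included in the list so that its component can be extracted later. *)
Lemma pcomp_decomposition q (u : 'I_q -> S) (sh : 'I_q -> int) t :
  exists s : seq int, [/\ uniq s, t \in s &
    forall l, u l = \sum_(i <- s) pcomp (i + sh l) (u l)].
Proof.
pose s0 := flatten [seq [seq (mdeg m)%:Z - sh l | m <- msupp (u l)] | l <- enum 'I_q].
have mem_s l m : (u l)@_m != 0 -> (mdeg m)%:Z - sh l \in undup (t :: s0).
  move=> um; rewrite mem_undup inE; apply/orP; right; apply/flattenP.
  exists [seq (mdeg m)%:Z - sh l | m <- msupp (u l)]; first by apply/map_f; rewrite mem_enum.
  by apply/(map_f (fun m : 'X_{1..n} => (mdeg m)%:Z - sh l)); rewrite mcoeff_msupp.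
exists (undup (t :: s0)); split; [exact: undup_uniq | by rewrite mem_undup inE eqxx |].
move=> l; apply/mpolyP => m; rewrite raddf_sum.
have [um0|um] := eqVneq ((u l)@_m) 0.
  by rewrite big1 ?um0 // => i _; rewrite /= mcoeff_pcomp um0 if_same.
rewrite (bigD1_seq _ (mem_s _ _ um)) ?undup_uniq // [in RHS]/= -[LHS]addr0.
congr (_ + _); last first.
  rewrite big1 // => i ne_i; rewrite /= mcoeff_pcomp; case: eqP => // em.
  by rewrite em addrK eqxx in ne_i.
by rewrite mcoeff_pcomp subrK eqxx.
Qed.

End PolynomialComponents.

Section StandardGradedLemmas.
Variables (k : fieldType) (R : comAlgType k) (G : nat -> R -> Prop).
Hypothesis stG : standard_graded G.
Variables (n : nat) (x : 'I_n -> R).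
Hypothesis px : presentation G x.

Lemma std_grading : grading G. Proof. by have [] := stG. Qed.
Lemma std_mul i j r s : G i r -> G j s -> G (i + j) (r * s).
Proof. by have [_ GM _ _] := stG; apply: GM. Qed.
Lemma std_alg c : G 0 c%:A.
Proof. by have [_ _ G0 _] := stG; apply/G0; exists c. Qed.
Lemma std_zero i : G i 0.
Proof. by have [/(_ i)[? _] _ _] := std_grading. Qed.
Lemma std_sub i r s : G i r -> G i s -> G i (r - s).
Proof. by have [/(_ i)[_ GB] _ _] := std_grading; apply: GB. Qed.
Lemma std_add i r s : G i r -> G i s -> G i (r + s).
Proof.
move=> Gr Gs; rewrite -[s]opprK -[- s]sub0r; apply: std_sub => //.
by apply: std_sub => //; apply: std_zero.
Qed.
Lemma std_scale i c r : G i r -> G i (c *: r).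
Proof. by move=> Gr; rewrite -mulr_algl -[i]add0n; apply: std_mul => //; apply: std_alg. Qed.
Lemma std_sum i (I : Type) (s : seq I) (P : pred I) F :
  (forall j, P j -> G i (F j)) -> G i (\sum_(j <- s | P j) F j).
Proof. by move=> GF; elim/big_ind: _ => //; [apply: std_zero | apply: std_add]. Qed.
Lemma std_exp i r N : G i r -> G (i * N)%N (r ^+ N).
Proof.
move=> Gr; elim: N => [|N IH]; first by rewrite muln0 expr0 -(scale1r (1 : R)); apply: std_alg.
by rewrite exprS mulnS; apply: std_mul.
Qed.

Lemma zgr_sum i (I : Type) (s : seq I) (P : pred I) F :
  (forall j, P j -> zgr G i (F j)) -> zgr G i (\sum_(j <- s | P j) F j).
Proof.
case: i => [i|i] /= GF; first exact: std_sum.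
exact: big1.
Qed.

Lemma zgr_mul i j r s : zgr G i r -> zgr G j s -> zgr G (i + j) (r * s).
Proof.
have z0 d : zgr G d 0 by case: d => //= d; apply: std_zero.
case: i => [i|i] /= Gr; last by rewrite Gr mul0r => _; apply: z0.
case: j => [j|j] /= Gs; last by rewrite Gs mulr0; apply: z0.
exact: std_mul.
Qed.

HB.instance Definition _ := GRing.RMorphism.copy (poly_eval x) (mmap (in_alg R) x).

Lemma poly_evalC c : poly_eval x c%:MP = c%:A.
Proof. exact: mmapC. Qed.

Lemma poly_evalX i : poly_eval x 'X_i = x i.
Proof. by rewrite /poly_eval mmapX mmap1U. Qed.

Lemma poly_eval_gr d p : mpoly_gr d p -> zgr G d (poly_eval x p).
Proof.
case: d => [d|d] /= hp; last by rewrite hp rmorph0.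
rewrite /poly_eval /mmap big_seq; apply: std_sum => m /(dhomog_mf hp) <-.
rewrite /= mulr_algl; apply: std_scale.
rewrite /mmap1 mdegE; have [x1 _] := px.
elim/big_rec2: _ => [|i r d' _ Gr]; first by rewrite -(scale1r (1 : R)); apply: std_alg.
by apply: std_mul => //; have := std_exp (m i) (x1 i); rewrite mul1n.
Qed.

(** Evaluation preserves degrees, so that the component of degree [j] of any
    preimage of [r] is still a preimage. *)
Lemma homogeneous_lift j r : G j r -> exists2 p, mpoly_gr j%:Z p & poly_eval x p = r.
Proof.
move=> Gr; have [_ /(_ r)[p pr]] := px.
have [s [s_uniq js sE]] := pcomp_decomposition (fun _ : 'I_1 => p) (fun=> 0) j%:Z.
exists (pcomp j%:Z p); first exact: pcomp_gr.
apply: (grading_component (G := zgr G) (s := s) (f := fun i => poly_eval x (pcomp i p)) (j := j%:Z)) => //.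
- exact/grading_zgr/std_grading.
- by move=> i; apply/poly_eval_gr/pcomp_gr.
- rewrite -pr {1}(sE ord0) rmorph_sum; apply: eq_bigr => i _.
  by rewrite addr0.
Qed.

Section Lift.
Variables (q : nat) (aug : 'I_q -> R) (dg : 'I_q -> int).
Hypothesis aug_gr : forall l, zgr G (dg l) (aug l).
Hypothesis aug_onto : forall r, exists v : 'rV_q, \sum_l poly_eval x (v 0 l) * aug l = r.

Lemma homogeneous_row_lift j r : G j r -> exists v : 'rV_q,
  (forall l, mpoly_gr (j%:Z - dg l) (v 0 l)) /\ \sum_l poly_eval x (v 0 l) * aug l = r.
Proof.
move=> Gr; have [v vr] := aug_onto r.
have [s [s_uniq js sE]] := pcomp_decomposition (v 0) (fun l => - dg l) j%:Z.
exists (\row_l pcomp (j%:Z - dg l) (v 0 l)); split=> [l|].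
  by rewrite mxE; apply: pcomp_gr.
pose f i := \sum_l poly_eval x (pcomp (i - dg l) (v 0 l)) * aug l.
rewrite (eq_bigr (fun l => poly_eval x (pcomp (j%:Z - dg l) (v 0 l)) * aug l)); last first.
  by move=> l _; rewrite mxE.
apply: (grading_component (G := zgr G) (s := s) (f := f) (j := j%:Z)) => //.
- exact/grading_zgr/std_grading.
- move=> i; apply: zgr_sum => l _; rewrite -[i](subrK (dg l)) addrK.
  by apply: zgr_mul => //; apply/poly_eval_gr/pcomp_gr.
- rewrite -vr exchange_big; apply: eq_bigr => l _ /=.
  by rewrite -mulr_suml -rmorph_sum -sE.
Qed.

End Lift.
End StandardGradedLemmas.

(** * Local duality *)

Section PolynomialsAsFunctions.
Variables (k : fieldType) (n : nat).
Local Notation S := {mpoly k[n]}.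
Local Notation N0 := (fmod k (cone (n := n) set0 set0)).
Local Notation expo := ('I_n -> int).

Lemma cone0P (e : expo) : cone set0 set0 e <-> forall j, 0 <= e j.
Proof.
split=> [/cone_predP H j|H]; first by have := H j; rewrite !inE; apply.
by apply/cone_predP => j _; rewrite inE.
Qed.

Definition mnat (e : expo) : 'X_{1..n} := [multinom absz (e j) | j < n].

Lemma mnatK e : cone set0 set0 e -> mexp (mnat e) = e.
Proof.
move=> /cone0P He; apply/funext => j; rewrite /mexp mnmE.
by have := He j; lia.
Qed.

Lemma mexpK m : mnat (mexp m) = m.
Proof. by apply/mnmP => j; rewrite mnmE /mexp absz_nat. Qed.

Lemma cone_mexp m : cone set0 set0 (@mexp n m).
Proof. exact/cone0P. Qed.

Lemma mlin_indicator (q : S) m0 : mlin (fun m => (m == m0)%:R) q = q@_m0.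
Proof.
elim/mpolyind: q => [|c m q _ _ IH]; first by rewrite mlin0 mcoeff0.
by rewrite mlin_linear mlinX IH mcoeffD mcoeffZ mcoeffX.
Qed.

(** The unit power series: [q |-> q *: unit_fun] embeds the polynomials, and is
    [S]-linear by construction. *)
Definition unit_fun : N0 := mkf (fun e => (e == 0)%:R).

Lemma coef_unit_fun (q : S) e : cone set0 set0 e -> coef (q *: unit_fun) e = q@_(mnat e).
Proof.
move=> Ce; rewrite coefZ Ce -mlin_indicator; apply: mlin_eq => m _.
rewrite coef_mkf subr_eq0; have [->|ne_m] := eqVneq m (mnat e).
  by rewrite mnatK // subrr eqxx ifT //; apply/cone0P.
case: eqP => [em|_]; last by rewrite if_same.
by rewrite em mexpK eqxx in ne_m.
Qed.

Lemma unit_fun_inj (q : S) : q *: unit_fun = 0 -> q = 0.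
Proof.
move=> q0; apply/mpolyP => m; rewrite mcoeff0 -{1}(mexpK m) -coef_unit_fun ?q0 ?coef0 //.
exact: cone_mexp.
Qed.

Lemma unit_fun_gr d (q : S) : mpoly_gr d q -> fproj d (q *: unit_fun) = q *: unit_fun.
Proof.
move=> hq; rewrite -[d]add0r -(fproj_scale _ _ hq); congr (_ *: _).
apply: coefP => e Ce; rewrite coef_fproj; case: eqP => // We.
rewrite coef_mkf Ce; case: eqP => // e0; case: We.
by rewrite e0 /weight big1.
Qed.

(** Only finitely many monomials have a given degree. *)
Lemma unit_fun_onto d (f : N0) : fproj d f = f -> exists2 q : S, mpoly_gr d q & q *: unit_fun = f.
Proof.
move=> hf; have f0 e : weight e != d -> coef f e = 0.
  by move=> /negPf We; rewrite -hf coef_fproj We.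
pose q : S := \sum_(m : 'X_{1..n < (absz d).+1}) coef f (mexp m) *: 'X_[m].
have qE m : q@_m = coef f (mexp m).
  have [lt_m|ge_m] := ltnP (mdeg m) (absz d).+1; first exact: (mcoeff_mpoly (fun m => coef f (mexp m))  lt_m).
  rewrite f0; last by rewrite weight_mexp; apply/eqP; lia.
  rewrite raddf_sum big1 // => m' _; rewrite /= mcoeffZ mcoeffX.
  case: eqP => [em|_]; last by rewrite mulr0.
  by move: ge_m; rewrite -em ltnNge -ltnS bmdeg.
exists q; last by apply: coefP => e Ce; rewrite coef_unit_fun // qE mnatK.
apply/mpoly_grP => m; rewrite qE => cm; apply/eqP; rewrite -weight_mexp.
by apply: contraR cm => /f0 ->.
Qed.

End PolynomialsAsFunctions.

Section SeriesFunctionals.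
Variables (k : fieldType) (R : comAlgType k) (G : nat -> R -> Prop).
Implicit Type c : nat -> R -> k.

(** [c] encodes the [k[y]]-linear map [s |-> sum_m c m s * y ^ m] with values
    in [k[[y]]]. *)
Definition series_on (y : R) c : Prop :=
  [/\ forall m a r s, c m (a *: r + s) = a * c m r + c m s,
      forall r, c 0 (y * r) = 0
    & forall m r, c m.+1 (y * r) = c m r].

(** The shift by [t - 1] comes from the normalization of the canonical module:
    the one of [k[y]] is generated in degree 1. *)
Definition series_degree (t : int) c : Prop :=
  forall j r m, G j r -> c m r != 0 -> m%:Z = j%:Z + t - 1.

(** The correspondence between [w] and its functional [c] is only used through
    annihilators, hence this weak form of linearity and injectivity. *)
Definition represents (y : R) (M : lmodType R) (t : int) (w : M) c : Prop :=
  [/\ series_on y c, series_degree t c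
    & forall j r, G j r -> (r *: w = 0 <-> forall m s, c m (r * s) = 0)].

End SeriesFunctionals.

Section CanonicalModule.
Variables (k : fieldType) (R : comAlgType k) (G : nat -> R -> Prop).
Hypothesis stG : standard_graded G.
Variables (n : nat) (x : 'I_n -> R).
Hypothesis px : presentation G x.
Variable F : graded_free_resolution G x.
Variable i0 : 'I_n.
Hypothesis y_reg : forall r, x i0 * r = 0 -> r = 0.
Hypothesis y_par : forall i, exists N r, x i ^+ N = x i0 * r.
Variables (M : lmodType R) (GM : int -> M -> Prop) (g : nat).
Hypothesis grM : graded_module G GM.
Hypothesis isoM : iso_Ext F g GM.
Hypothesis M_neq0 : exists t w, GM t w /\ w <> 0.

Local Notation S := {mpoly k[n]}.
Local Notation N0 := (fmod k (cone (n := n) set0 set0)).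
Local Notation L := (fmod k (last_cone i0)).
Local Notation b := (frank F).
Local Notation D := (@fdiff _ _ _ _ _ F).
Local Notation dg := (@fdeg _ _ _ _ _ F).
Local Notation ev := (poly_eval x : {rmorphism S -> R}).

Let F_res : resolution ev D (@faug _ _ _ _ _ F).
Proof. split; [exact: faug_surj | exact: faug_exact | exact: fdiff_exact]. Qed.

Let homD : forall i j l, @mpoly_gr k n (dg j - dg l) (D i j l).
Proof. exact: fdiff_homog. Qed.

Let y_reg' r : ev 'X_i0 * r = 0 -> r = 0.
Proof. by rewrite /= poly_evalX; apply: y_reg. Qed.

Let y_par' i : i != i0 -> exists N h, ev ('X_i ^+ N - 'X_i0 * h) = 0.
Proof.
move=> _; have [N [r Hr]] := y_par i; have [_ /(_ r)[h hr]] := px.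
by exists N, h; rewrite rmorphB rmorphM rmorphXn /= !poly_evalX hr Hr subrr.
Qed.

Definition fun_cochain i (u : 'cV[S]_(b i)) : 'I_(b i) -> N0 := fun l => u l 0 *: @unit_fun k n.

Lemma fun_cochain_mul i (u : 'cV[S]_(b i)) :
  fun_cochain (D i *m u) = mxact (D i) (fun_cochain u).
Proof.
apply/funext => j; rewrite /fun_cochain /mxact mxE scaler_suml.
by apply: eq_bigr => l _; rewrite scalerA.
Qed.

Lemma fun_cochain_inj i (u v : 'cV[S]_(b i)) : fun_cochain u = fun_cochain v -> u = v.
Proof.
move=> uv; apply/colP => l; apply/eqP; rewrite -subr_eq0; apply/eqP/unit_fun_inj.
rewrite scalerBl; apply/eqP; rewrite subr_eq0; apply/eqP.
exact: (congr1 (fun f => f l) uv).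
Qed.

Lemma fun_cochain_cocycle i (u : 'cV[S]_(b i)) : cocycle u <-> cocyc D (fun_cochain u).
Proof.
rewrite /cocycle /cocyc -fun_cochain_mul; split=> [->|Du0].
  by apply/funext => l; rewrite /fun_cochain mxE scale0r.
apply: fun_cochain_inj; rewrite Du0; apply/funext => l.
by rewrite /fun_cochain mxE scale0r.
Qed.

Lemma fun_cochain_gr i t (u : 'cV[S]_(b i)) : cochain_degree t u ->
  cochain_proj dg (@fproj k n _) (t - n%:Z) (fun_cochain u) = fun_cochain u.
Proof.
move=> tu; apply/funext => l; rewrite /cochain_proj /fun_cochain unit_fun_gr //.
by rewrite addrAC; apply: tu.
Qed.

Lemma fun_cochain_onto i t (f : 'I_(b i) -> N0) :
  cochain_proj dg (@fproj k n _) (t - n%:Z) f = f ->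
  exists2 u, cochain_degree t u & fun_cochain u = f.
Proof.
move=> tf; have /choice[u Hu] l : exists q : S,
    mpoly_gr (t + dg l - n%:Z) q /\ q *: @unit_fun k n = f l.
  have [|q hq qf] := @unit_fun_onto k n (t + dg l - n%:Z) (f l).
    by rewrite -{2}tf /cochain_proj addrAC.
  by exists q.
exists (\col_l u l); first by move=> l; rewrite mxE; have [] := Hu l.
by apply/funext => l; rewrite /fun_cochain mxE; have [] := Hu l.
Qed.

(** A primitive in power series of a homogeneous cochain can be replaced by its
    component of the right degree, which is polynomial. *)
Lemma fun_cochain_cobound t (u : 'cV[S]_(b g)) : cochain_degree t u ->
  coboundary u <-> cobound D (fun_cochain u).
Proof.
move=> tu; have := fun_cochain_gr tu; case: g u tu => [|i] u tu tu' /=.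
  split=> [->|u0]; first by apply/funext => l; rewrite /fun_cochain mxE scale0r.
  apply: fun_cochain_inj; rewrite u0; apply/funext => l.
  by rewrite /fun_cochain mxE scale0r.
split=> [[w ->]|[w Hw]]; first by exists (fun_cochain w); rewrite fun_cochain_mul.
pose w' := cochain_proj dg (@fproj k n _) (t - n%:Z) w.
have [|v tv vw] := @fun_cochain_onto _ t w'.
  apply/funext => l; apply: coefP => e Ce.
  by rewrite /w' /cochain_proj !coef_fproj; case: (weight e == _).
exists v; apply: fun_cochain_inj; rewrite fun_cochain_mul vw.
have [_ gr] := fproj_graded homD (cone set0 set0).
by rewrite /w' gr -Hw tu'.
Qed.

Let psi := sval (cid isoM).
Let psiP := svalP (cid isoM).

(** The components of a cocycle are cocycles, and the one of degree [t] is mapped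
    to [w] because the components of [w] are unique. *)
Lemma homogeneous_cocycle t w : GM t w ->
  exists u, [/\ cocycle u, cochain_degree t u & psi u = w].
Proof.
move=> Gw; have [psiD _ psi_onto _ psi_gr] := psiP.
have [u0 cu0 uw] := psi_onto w.
have [s [s_uniq ts sE]] :=
  pcomp_decomposition (fun l => u0 l 0) (fun l => dg l - n%:Z) t.
pose u i : 'cV[S]_(b g) := \col_l pcomp (i + (dg l - n%:Z)) (u0 l 0).
have u_gr i : cochain_degree i (u i).
  by move=> l; rewrite mxE addrA; apply: pcomp_gr.
have uE i : fun_cochain (u i) =
    cochain_proj dg (@fproj k n _) (i - n%:Z) (fun_cochain u0).
  apply/funext => l; apply: coefP => e Ce.
  rewrite /cochain_proj coef_fproj !coef_unit_fun // mxE mcoeff_pcomp.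
  by rewrite -weight_mexp mnatK // addrA addrAC.
have u_cocycle i : cocycle (u i).
  apply/fun_cochain_cocycle; rewrite uE.
  have [e0 gr] := fproj_graded homD (cone set0 set0).
  rewrite /cocyc gr; move/fun_cochain_cocycle: cu0 => ->.
  by apply/funext => l; apply: e0.
have u_sum : u0 = \sum_(i <- s) u i.
  apply/colP => l; rewrite summxE sE; apply: eq_bigr => i _.
  by rewrite mxE.
exists (u t); split=> //.
have [grGM _] := grM.
apply: (grading_component (f := fun i => psi (u i)) grGM s_uniq ts) => //.
  by move=> i; apply: psi_gr.
rewrite -uw u_sum.
suff [] : cocycle (\sum_(i <- s) u i) /\ psi (\sum_(i <- s) u i) = \sum_(i <- s) psi (u i) by [].
elim: s {s_uniq ts sE u_sum} => [|i s [IH1 IH2]].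
  rewrite !big_nil /cocycle mulmx0; split=> //.
  have c0 : cocycle (0 : 'cV[S]_(b g)) by rewrite /cocycle mulmx0.
  by apply: (addrI (psi 0)); rewrite -psiD // !addr0.
rewrite !big_cons /psi psiD // -/psi IH2; split=> //.
by rewrite /cocycle mulmxDr u_cocycle IH1 addr0.
Qed.

Lemma psi_eq0 t u : cocycle u -> cochain_degree t u ->
  psi u = 0 <-> cobound D (fun_cochain u).
Proof.
have [_ _ _ psi0 _] := psiP.
by move=> /psi0 -> /fun_cochain_cobound.
Qed.

(** Below [n - 1] the [Ext] module vanishes by [low_cohomology_vanishes]; above,
    the connecting isomorphisms lead to the last cone in a positive degree, where
    it has no cohomology. *)
Lemma ext_degree : g = n.-1.
Proof.
have [t [w [Gw w_neq0]]] := M_neq0.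
have [u [cu tu uw]] := homogeneous_cocycle Gw.
have ncob : ~ cobound D (fun_cochain u).
  by move=> /(psi_eq0 cu tu); rewrite uw.
have [lt_g|gt_g|//] := ltngtP g n.-1; case: ncob.
  apply: (low_cohomology_vanishes F_res homD y_par') => //.
  exact/fun_cochain_cocycle.
have i0L : i0 \notin ~: [set i0] by rewrite !inE eqxx.
have cardL : #|~: [set i0]| = n.-1 by rewrite cardsC1 card_ord.
have gE : g = ((g - n.-1).-1.+1 + n.-1)%N by lia.
have [rho Hrho] := cone_cohomology_iso F_res homD y_par' cardL i0L gE.
have [u' uu'] := coh_iso_total Hrho (proj1 (fun_cochain_cocycle u) cu).
apply/(coh_iso_cobound Hrho uu'); have [_ cu'] := coh_iso_cocyc Hrho uu'.
exact: (last_cone_cohomology_vanishes F_res y_reg' cu').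
Qed.

Local Notation eps := (augment ev (@faug _ _ _ _ _ F)).

Lemma pairing_augment (u : 'I_(b 0) -> L) v v' :
  cocyc D u -> eps v = eps v' -> pairing v u = pairing v' u.
Proof.
move=> cu vv'; have [_ ex0 _] := F_res.
have /ex0[w vE] : eps (v + (-1) *: v') = 0.
  by rewrite augmentD augmentZ vv' rmorphN1 mulN1r subrr.
have : pairing (v + (-1) *: v') u = 0 by rewrite vE pairingM cu /pairing mxact0.
rewrite pairingDl pairingZ scaleN1r => /eqP; rewrite subr_eq0 => /eqP.
by [].
Qed.

(** In degree 0 a cocycle is a homomorphism from the resolved module [R]. *)
Lemma cocycle_series (u : 'I_(b 0) -> L) : cocyc D u ->
  exists c, series_on (x i0) c /\ forall m v, c m (eps v) = res m (pairing v u).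
Proof.
move=> cu; have [ex _ _] := F_res; have [lift liftK] := choice ex.
have cE m v : res m (pairing (lift (eps v)) u) = res m (pairing v u).
  by congr (res _ _); apply: pairing_augment; rewrite ?liftK.
exists (fun m s => res m (pairing (lift s) u)); split=> //.
have [linU U0 US] := res_pairing_series u.
have yE v : x i0 * eps v = eps ('X_i0 *: v) by rewrite augmentZ /= poly_evalX.
split=> [m a r s|r|m r].
- rewrite -(liftK r) -(liftK s) -mulr_algl -(poly_evalC x) -augmentZ -augmentD !cE.
  exact: linU.
- by rewrite -(liftK r) yE cE.
- by rewrite -(liftK r) yE !cE.
Qed.

Lemma pairing_proj (t j : int) (u : 'I_(b 0) -> L) (v : 'rV[S]_(b 0)) :
  (forall l, mpoly_gr (j - dg l) (v 0 l)) ->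
  pairing v (cochain_proj dg (@fproj k n _) t u) = fproj (t + j) (pairing v u).
Proof.
move=> v_gr; rewrite /pairing /mxact.
have -> : fproj (t + j) (\sum_l v 0 l *: u l) = \sum_l fproj (t + j) (v 0 l *: u l).
  apply: coefP => e Ce; rewrite coef_fproj !coef_sum; case: ifP => We.
    by apply: eq_bigr => l _; rewrite coef_fproj We.
  by rewrite big1 // => l _; rewrite coef_fproj We.
apply: eq_bigr => l _; rewrite (fproj_scale _ _ (v_gr l)).
by congr fproj; ring.
Qed.

Lemma res_pairing_proj (t j : int) (m : nat) (u : 'I_(b 0) -> L) (v : 'rV[S]_(b 0)) :
  (forall l, mpoly_gr (j - dg l) (v 0 l)) ->
  res m (pairing v (cochain_proj dg (@fproj k n _) (t - n%:Z) u)) =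
  if m%:Z == j + t - 1 then res m (pairing v u) else 0.
Proof.
move=> v_gr; rewrite (pairing_proj _ _ v_gr) /res coef_fproj weight_line.
have n_gt0 : (0 < n)%N by apply: leq_trans (ltn_ord i0).
have -> : (m%:Z - (n.-1)%:Z == t - n%:Z + j) = (m%:Z == j + t - 1) by apply/eqP/eqP; lia.
by [].
Qed.

Lemma augment_lift j r : G j r ->
  exists v : 'rV[S]_(b 0), (forall l, mpoly_gr (j%:Z - dg l) (v 0 l)) /\ eps v = r.
Proof.
apply: (homogeneous_row_lift stG px); first exact: faug_homog.
exact: faug_surj.
Qed.

Let connecting_iso : exists rho, @coh_iso _ b D dg N0 L (@fproj k n _) (@fproj k n _) g 0 rho.
Proof.
have i0L : i0 \notin ~: [set i0] by rewrite !inE eqxx.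
have cardL : #|~: [set i0]| = n.-1 by rewrite cardsC1 card_ord.
have gE : g = (0 + n.-1)%N by rewrite ext_degree.
exact: (cone_cohomology_iso F_res homD y_par' cardL i0L gE).
Qed.

(** Whether [r *: w] vanishes can be tested on [r *: u], on the corresponding
    cocycle of degree 0 with values in [L], and finally on residues. *)
Lemma connected_represents rho t (u : 'cV[S]_(b g)) (u' : 'I_(b 0) -> L) c :
  @coh_iso _ b D dg N0 L (@fproj k n _) (@fproj k n _) g 0 rho ->
  cocycle u -> cochain_degree t u -> rho (fun_cochain u) u' ->
  cochain_proj dg (@fproj k n _) (t - n%:Z) u' = u' ->
  series_on (x i0) c -> (forall m v, c m (eps v) = res m (pairing v u')) ->
  represents G (x i0) t (psi u) c.
Proof.
move=> Hrho cu tu uu' tu' ser_c cE; split=> // [j r m Gr|j r Gr].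
  have [v [v_gr vr]] := augment_lift Gr.
  rewrite -vr cE -tu' (res_pairing_proj _ _ _ v_gr).
  by case: ifP => [/eqP|]; rewrite ?eqxx.
have [p p_gr pr] := homogeneous_lift stG px Gr.
have [_ psiZ _ _ _] := psiP.
rewrite -pr -psiZ //.
have cpu : cocycle (p *: u) by rewrite /cocycle -scalemxAr cu scaler0.
have pu_gr : cochain_degree (t + j%:Z) (p *: u).
  move=> l; rewrite mxE; apply/mpoly_grP => m; rewrite -mcoeff_msupp => /msuppM_le /allpairsP[].
  case=> m1 m2 /= [m1p m2u ->]; rewrite mdegD PoszD.
  have /mpoly_grP -> : mpoly_gr j%:Z p by [].
    have /mpoly_grP -> := tu l; first by ring.
    by rewrite -mcoeff_msupp.
  by rewrite -mcoeff_msupp.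
have pu_fun : fun_cochain (p *: u) = (fun l => p *: fun_cochain u l).
  by apply/funext => l; rewrite /fun_cochain mxE scalerA.
rewrite (psi_eq0 cpu pu_gr) pu_fun.
have cob0 : rho 0 0.
  have [u0 u00] : exists u0, rho u0 0.
    by apply: (coh_iso_surj Hrho); rewrite /cocyc mxact0.
  have := coh_iso_lin Hrho (-1) u00 u00.
  have -> : (fun l => -1 *: u0 l) + u0 = 0 by apply/funext => l; rewrite /= [LHS]addrC scaleN1r subrr.
  by have -> : (fun l => -1 *: (0 : 'I_(b 0) -> L) l) + 0 = 0
    by apply/funext => l; rewrite /= [LHS]addrC scaleN1r subrr.
have rho_pu : rho (fun l => p *: fun_cochain u l) (fun l => p *: u' l).
  by have := coh_iso_lin Hrho p uu' cob0; rewrite !addr0.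
rewrite (coh_iso_cobound Hrho rho_pu) /=.
have pairZ v : pairing v (fun l => p *: u' l) = pairing (p *: v) u'.
  by rewrite /pairing mxactZ -/(pairing v u') -pairingZ.
have cpE m v : c m (poly_eval x p * eps v) = res m (pairing v (fun l => p *: u' l)).
  by rewrite pairZ -cE augmentZ.
have [ex _ _] := F_res.
split=> [pu0 m s|c0]; first by have [v <-] := ex s; rewrite cpE pu0 /pairing mxact0 res0.
by apply: res_pairing_eq0 => m v; rewrite -cpE c0.
Qed.

(** Local duality, in one direction: the elements of the canonical module are
    homogeneous functionals on [R] linear over [k[y]]. *)
Lemma canonical_represented t w : GM t w -> exists c, represents G (x i0) t w c.
Proof.
move=> Gw; have [u [cu tu <-]] := homogeneous_cocycle Gw.
have [rho Hrho] := connecting_iso.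
have [u' uu'] := coh_iso_total Hrho (proj1 (fun_cochain_cocycle u) cu).
have := coh_iso_proj Hrho (t - n%:Z) uu'; rewrite fun_cochain_gr // => tuu'.
have [_ ctu'] := coh_iso_cocyc Hrho tuu'.
have [c [ser_c cE]] := cocycle_series ctu'.
exists c; apply: (connected_represents Hrho cu tu tuu' _ ser_c cE).
apply/funext => l; apply: coefP => e Ce.
by rewrite /cochain_proj !coef_fproj; case: (weight e == _).
Qed.

(** Local duality, in the other direction. The function that represents [c] is
    projected to degree [t], so that the agreement is stated on homogeneous
    elements. *)
Lemma represented_canonical t c : series_on (x i0) c -> series_degree G t c ->
  exists w c', [/\ GM t w, represents G (x i0) t w c' &
    forall j s m, G j s -> c' m s = c m s].
Proof.
move=> ser_c deg_c; have [rho Hrho] := connecting_iso.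
have [lin_c c0 cS] := ser_c.
have [|u Hu] := @series_functional_representable k n i0 _ (fun m v => c m (eps v)).
  split=> [m a v w|v|m v].
  - by rewrite augmentD augmentZ /= poly_evalC mulr_algl lin_c.
  - by rewrite augmentZ /= poly_evalX c0.
  - by rewrite augmentZ /= poly_evalX cS.
have cu : cocyc D u.
  apply: res_pairing_eq0 => m v; rewrite -pairingM Hu.
  have [_ ex0 _] := F_res; have -> : eps (v *m D 0) = 0 by apply/ex0; exists v.
  by have := lin_c m (-1) 0 0; rewrite scaler0 addr0 mulN1r addNr.
have [f fu] := coh_iso_surj Hrho cu.
have := coh_iso_proj Hrho (t - n%:Z) fu.
set tu := cochain_proj _ _ _ u; set tf := cochain_proj _ _ _ f => tfu.
have proj_idem i C (h : 'I_(b i) -> fmod k C) :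
    cochain_proj dg (@fproj k n _) (t - n%:Z) (cochain_proj dg (@fproj k n _) (t - n%:Z) h)
    = cochain_proj dg (@fproj k n _) (t - n%:Z) h.
  apply/funext => l; apply: coefP => e Ce.
  by rewrite /cochain_proj !coef_fproj; case: (weight e == _).
have [v tv vf] := fun_cochain_onto (proj_idem _ _ f).
have [ctf ctu] := coh_iso_cocyc Hrho tfu.
have cv : cocycle v by apply/fun_cochain_cocycle; rewrite vf.
have [c' [ser_c' cE']] := cocycle_series ctu.
have [_ _ _ _ psi_gr] := psiP.
exists (psi v), c'; split; first exact: psi_gr.
  apply: (connected_represents Hrho cv tv _ (proj_idem _ _ u) ser_c' cE').
  by rewrite vf.
move=> j s m Gs; have [z [z_gr zs]] := augment_lift Gs.
rewrite -zs cE' (res_pairing_proj _ _ _ z_gr) Hu; case: eqP => // ne_m.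
by apply/esym/eqP; apply: contra_notT ne_m => /(deg_c j); apply; rewrite zs.
Qed.

End CanonicalModule.

(** * Change of coordinates *)

Section ChangeOfCoordinates.
Variables (k : fieldType) (n : nat).
Local Notation S := {mpoly k[n]}.

Lemma mpoly_rmorphism_ext (A : comNzRingType) (f f' : {rmorphism S -> A}) :
  (forall c, f c%:MP = f' c%:MP) -> (forall i, f 'X_i = f' 'X_i) -> f =1 f'.
Proof.
move=> eqC eqX; elim/mpolyind => [|c m p _ _ IH]; first by rewrite !rmorph0.
rewrite !rmorphD IH -mul_mpolyC !rmorphM eqC mpolyXE_id !rmorph_prod; congr (_ * _ + _).
by apply: eq_bigr => i _; rewrite !rmorphXn eqX.
Qed.

Lemma substitution_gr (h : 'I_n -> S) d p :
  (forall i, h i \is 1.-homog) -> mpoly_gr d p -> mpoly_gr d (poly_eval h p).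
Proof.
move=> h1; case: d => [d|d] /= hp; last by rewrite hp rmorph0.
rewrite /poly_eval /mmap big_seq; apply: rpred_sum => m /(dhomog_mf hp) <-.
rewrite /= mulr_algl; apply: dhomogZ.
rewrite /mmap1 mdegE; elim/big_rec2: _ => [|i q d' _ hq]; first exact: dhomog1.
by apply: dhomogM => //; have := dhomogMn (m i) (h1 i); rewrite mul1n.
Qed.

Variables (R : comAlgType k) (G : nat -> R -> Prop) (x : 'I_n -> R).
Hypothesis px : presentation G x.
Variables (i0 : 'I_n) (c : 'I_n -> k).
Hypothesis c_i0 : c i0 != 0.
Let y := \sum_i c i *: x i.
Hypothesis Gy : G 1%N y.

Definition new_coordinates (i : 'I_n) : R := if i == i0 then y else x i.

(** Mutually inverse substitutions. The forward one expresses the old variable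
    [X_i0] through the new one, whose image is the linear form [y]. *)
Definition forward_sub (i : 'I_n) : S :=
  if i == i0 then (c i0)^-1 *: ('X_i0 - \sum_(j | j != i0) c j *: 'X_j) else 'X_i.

Definition backward_sub (i : 'I_n) : S := if i == i0 then \sum_j c j *: 'X_j else 'X_i.

Local Notation fwd := (poly_eval forward_sub).
Local Notation bwd := (poly_eval backward_sub).

Lemma poly_eval_scale (A : comAlgType k) (z : 'I_n -> A) d (p : S) :
  poly_eval z (d *: p) = d *: poly_eval z p.
Proof. by rewrite /poly_eval mmapZ /= mulr_algl. Qed.

Lemma poly_eval_lin (A : comAlgType k) (z : 'I_n -> A) (P : pred 'I_n) :
  poly_eval z (\sum_(j | P j) c j *: 'X_j) = \sum_(j | P j) c j *: z j.
Proof.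
by rewrite rmorph_sum; apply: eq_bigr => j _; rewrite /= poly_eval_scale poly_evalX.
Qed.

Lemma poly_eval_comp (A : comAlgType k) (z : 'I_n -> S) (z' z'' : 'I_n -> A) p :
  (forall i, poly_eval z' (z i) = z'' i) ->
  poly_eval z' (poly_eval z p) = poly_eval z'' p.
Proof.
move=> zz; rewrite -[LHS]/((poly_eval z' \o poly_eval z) p).
apply: mpoly_rmorphism_ext => [d|i] /=; last by rewrite !poly_evalX.
by rewrite !poly_evalC alg_mpolyC poly_evalC.
Qed.

Lemma poly_evalXid p : poly_eval (fun i => 'X_i : S) p = p.
Proof.
rewrite -[RHS]/(idfun p); apply: mpoly_rmorphism_ext => [d|i] /=.
  by rewrite poly_evalC alg_mpolyC.
by rewrite poly_evalX.
Qed.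

Lemma bwdK p : fwd (bwd p) = p.
Proof.
rewrite -[RHS]poly_evalXid; apply: poly_eval_comp => i; rewrite /backward_sub.
case: eqVneq => [->|ne_i]; last by rewrite poly_evalX /forward_sub (negPf ne_i).
rewrite poly_eval_lin (bigD1 i0) //= {1}/forward_sub eqxx scalerA divff // scale1r.
by rewrite -addrA [X in _ + X](_ : _ = 0) ?addr0 // addrC -sumrB big1 // => j /negPf ne_j;
   rewrite /forward_sub ne_j subrr.
Qed.

Lemma fwdK p : bwd (fwd p) = p.
Proof.
rewrite -[RHS]poly_evalXid; apply: poly_eval_comp => i; rewrite /forward_sub.
case: eqVneq => [->|ne_i]; last by rewrite poly_evalX /backward_sub (negPf ne_i).
rewrite poly_eval_scale rmorphB /= poly_evalX poly_eval_lin {1}/backward_sub eqxx (bigD1 i0) //=.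
rewrite -addrA -sumrB [X in _ + X]big1 => [|j /negPf ne_j]; last first.
  by rewrite /backward_sub ne_j subrr.
by rewrite addr0 scalerA mulVf // scale1r.
Qed.

Lemma eval_bwd p : poly_eval x (bwd p) = poly_eval new_coordinates p.
Proof.
apply: poly_eval_comp => i; rewrite /backward_sub /new_coordinates.
by case: eqP => _; rewrite ?poly_eval_lin ?poly_evalX.
Qed.

Lemma eval_fwd p : poly_eval new_coordinates (fwd p) = poly_eval x p.
Proof. by rewrite -eval_bwd fwdK. Qed.

Lemma fwd_gr d p : mpoly_gr d p -> mpoly_gr d (fwd p).
Proof.
apply: substitution_gr => i; rewrite /forward_sub; case: eqP => _; last by rewrite dhomogX /= mdeg1.
apply: dhomogZ; apply: rpredB; first by rewrite dhomogX /= mdeg1.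
by apply: rpred_sum => j _; apply: dhomogZ; rewrite dhomogX /= mdeg1.
Qed.

Lemma bwd_gr d p : mpoly_gr d p -> mpoly_gr d (bwd p).
Proof.
apply: substitution_gr => i; rewrite /backward_sub; case: eqP => _; last by rewrite dhomogX /= mdeg1.
by apply: rpred_sum => j _; apply: dhomogZ; rewrite dhomogX /= mdeg1.
Qed.

Lemma new_presentation : presentation G new_coordinates.
Proof.
have [x1 x_onto] := px; split=> [i|r].
  by rewrite /new_coordinates; case: eqP.
by have [p <-] := x_onto r; exists (fwd p); rewrite eval_fwd.
Qed.

Lemma map_bwdK p q (A : 'M[S]_(p, q)) : map_mx fwd (map_mx bwd A) = A.
Proof. by apply/matrixP => i j; rewrite !mxE bwdK. Qed.

Lemma map_fwdK p q (A : 'M[S]_(p, q)) : map_mx bwd (map_mx fwd A) = A.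
Proof. by apply/matrixP => i j; rewrite !mxE fwdK. Qed.

Lemma map_fwd_eq0 p q (A : 'M[S]_(p, q)) : map_mx fwd A = 0 <-> A = 0.
Proof. by split=> [A0|->]; rewrite ?map_mx0 // -(map_fwdK A) A0 map_mx0. Qed.

Variable F : graded_free_resolution G x.

Definition new_resolution : graded_free_resolution G new_coordinates.
Proof.
refine (@GradedFreeResolution _ _ _ _ _ (frank F) (@fdeg _ _ _ _ _ F)
  (fun i => map_mx fwd (fdiff F i)) (@faug _ _ _ _ _ F) _ (@faug_homog _ _ _ _ _ F) _ _ _).
- by move=> i j l; rewrite mxE; apply/fwd_gr/fdiff_homog.
- move=> r; have [v <-] := faug_surj F r; exists (map_mx fwd v).
  by apply: eq_bigr => l _; rewrite mxE eval_fwd.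
- move=> v; have -> : \sum_l poly_eval new_coordinates (v 0 l) * faug (g := F) l =
      \sum_l poly_eval x (map_mx bwd v 0 l) * faug (g := F) l.
    by apply: eq_bigr => l _; rewrite mxE eval_bwd.
  split=> [/faug_exact[w vE]|[w ->]]; first by exists (map_mx fwd w); rewrite -map_mxM -vE map_bwdK.
  by apply/faug_exact; exists (map_mx bwd w); rewrite map_mxM map_fwdK.
- move=> i v.
  have -> : v *m map_mx fwd (fdiff F i) = map_mx fwd (map_mx bwd v *m fdiff F i).
    by rewrite map_mxM map_bwdK.
  rewrite map_fwd_eq0.
  split=> [/fdiff_exact[w vE]|[w ->]]; first by exists (map_mx fwd w); rewrite -map_mxM -vE map_bwdK.
  by apply/fdiff_exact; exists (map_mx bwd w); rewrite map_mxM map_fwdK.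
Defined.

Lemma new_cocycle i (u : 'cV[S]_(frank F i)) :
  cocycle (F := new_resolution) u <-> cocycle (F := F) (map_mx bwd u).
Proof.
rewrite /cocycle /=; have -> : map_mx fwd (fdiff F i) *m u = map_mx fwd (fdiff F i *m map_mx bwd u).
  by rewrite map_mxM map_bwdK.
exact: map_fwd_eq0.
Qed.

Lemma new_iso_Ext g (M : lmodType R) (GM : int -> M -> Prop) :
  iso_Ext F g GM -> iso_Ext new_resolution g GM.
Proof.
move=> [psi [psiD psiZ psi_onto psi0 psi_gr]].
exists (fun u => psi (map_mx bwd u)); split.
- by move=> u v /new_cocycle cu /new_cocycle cv; rewrite map_mxD psiD.
- by move=> p u /new_cocycle cu; rewrite map_mxZ psiZ // eval_bwd.
- move=> w; have [u cu uw] := psi_onto w.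
  exists (map_mx fwd u); last by rewrite map_fwdK.
  by apply/new_cocycle; rewrite map_fwdK.
- move=> u /new_cocycle cu; rewrite psi0 //; case: g u psi {psiD psiZ psi_onto psi0 psi_gr} cu => [|i] u _ _ /=.
    by split=> [b0|->]; rewrite ?map_mx0 // -(map_bwdK u) b0 map_mx0.
  split=> [[w uw]|[w ->]]; first by exists (map_mx fwd w); rewrite -map_mxM -uw map_bwdK.
  by exists (map_mx bwd w); rewrite map_mxM map_fwdK.
- move=> t u /new_cocycle cu tu; apply: psi_gr => // l.
  by rewrite mxE; apply/bwd_gr/tu.
Qed.

End ChangeOfCoordinates.

(** * Ideals and homogeneous components *)

Section Ideals.
Variable R : comNzRingType.
Implicit Types (X I J : R -> Prop).

Lemma ideal_gen_mem X r : X r -> ideal_gen X r.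
Proof.
by move=> Xr; exists [:: (1, r)]; rewrite big_seq1 scale1r; split=> // p; rewrite inE => /eqP ->.
Qed.

Lemma ideal_gen_is_ideal X : is_ideal (ideal_gen X).
Proof.
split.
- by exists [::]; rewrite big_nil; split.
- move=> _ _ [s [Xs ->]] [s' [Xs' ->]]; exists (s ++ s'); rewrite big_cat; split=> // p.
  by rewrite mem_cat => /orP[/Xs|/Xs'].
- move=> r _ [s [Xs ->]]; exists [seq (r * p.1, p.2) | p <- s]; split.
    by move=> _ /mapP[p /Xs Xp ->].
  by rewrite big_map mulr_sumr; apply: eq_bigr => p _; rewrite /= -[RHS]mulrA.
Qed.

Lemma ideal_gen_sub X I : is_ideal I -> (forall r, X r -> I r) -> sub_ideal (ideal_gen X) I.
Proof.
move=> [I0 ID IM] XI _ [s [Xs ->]]; rewrite big_seq.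
by elim/big_ind: _ => // p ps; apply: IM; apply/XI/Xs.
Qed.

Lemma ideal_sum I (T : Type) (s : seq T) (P : pred T) (f : T -> R) :
  is_ideal I -> (forall i, P i -> I (f i)) -> I (\sum_(i <- s | P i) f i).
Proof. by move=> [I0 ID _] If; elim/big_ind: _. Qed.

Lemma ideal_pow_is_ideal I n : is_ideal (ideal_pow I n).
Proof. by case: n => [|n] //; apply: ideal_gen_is_ideal. Qed.

Lemma ideal_of_seq1P (y r : R) : ideal_of_seq [:: y] r <-> exists s, r = y * s.
Proof.
split=> [Hr|].
  apply: (ideal_gen_sub (I := fun r => exists s, r = y * s) _ _ Hr) => [|z]; last by rewrite inE => /eqP ->; exists 1; rewrite mulr1.
  split=> [|z z' [s ->] [s' ->]|z _ [s ->]]; first by exists 0; rewrite mulr0.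
    by exists (s + s'); rewrite mulrDr.
  by exists (z * s); rewrite mulrCA.
move=> [s ->]; have [_ _ genM] := ideal_gen_is_ideal (fun z => z \in [:: y]).
by rewrite mulrC; apply/genM/ideal_gen_mem; rewrite inE.
Qed.

Lemma principal_powP (y : R) n (r : R) : ideal_pow (ideal_of_seq [:: y]) n r <-> exists s, r = y ^+ n * s.
Proof.
elim: n r => [|n IH] r; first by split=> // _; exists r; rewrite expr0 mul1r.
split=> [Hr|].
  apply: (ideal_gen_sub (I := fun r => exists s, r = y ^+ n.+1 * s) _ _ Hr) => [|_ [u [v [/ideal_of_seq1P[s ->] /IH[s' ->] ->]]]]; last first.
    by exists (s * s'); rewrite exprS; ring.
  split=> [|z z' [s ->] [s' ->]|z _ [s ->]]; first by exists 0; rewrite mulr0.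
    by exists (s + s'); rewrite mulrDr.
  by exists (z * s); rewrite mulrCA.
move=> [s ->]; apply: ideal_gen_mem; exists y, (y ^+ n * s); split.
- by apply/ideal_of_seq1P; exists 1; rewrite mulr1.
- by apply/IH; exists s.
- by rewrite exprS mulrA.
Qed.

Lemma ideal_pow_exp I n r : I r -> ideal_pow I n (r ^+ n).
Proof.
move=> Ir; elim: n => [|n IH] //; rewrite exprS.
by apply: ideal_gen_mem; exists r, (r ^+ n).
Qed.

Lemma krull_dim_uniq d d' : krull_dim R d -> krull_dim R d' -> d = d'.
Proof.
have shorten l l' c : prime_chain (R := R) l c -> (l' <= l)%N -> prime_chain l' c.
  move=> [c_prime c_strict] le_l; split=> i lt_i.
    exact/c_prime/(leq_trans lt_i).
  exact/c_strict/(leq_trans lt_i).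
move=> [[c Hc] no_c] [[c' Hc'] no_c'].
case: (ltngtP d d') => // lt_d; [case: no_c | case: no_c'].
  by exists c'; apply: shorten Hc' lt_d.
by exists c; apply: shorten Hc lt_d.
Qed.

End Ideals.

Section Components.
Variables (V : zmodType) (G : nat -> V -> Prop).
Hypothesis grG : grading G.

Definition decomposes (v : V) (f : nat -> V) : Prop :=
  (forall i, G i (f i)) /\
  exists N, (forall i, (N <= i)%N -> f i = 0) /\ v = \sum_(i < N) f i.

Lemma decomposes_ex v : exists f, decomposes v f.
Proof.
have [G_sub G_ex _] := grG; have [s [f [Gf ->]]] := G_ex v.
have G0 i : G i 0 by have [] := G_sub i.
have GD i u w : G i u -> G i w -> G i (u + w).
  have [_ GB] := G_sub i; move=> Gu Gw; rewrite -[w]opprK -[- w]sub0r.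
  by apply: (GB) => //; apply: GB.
exists (fun i => \sum_(j <- s | j == i) f j); split=> [i|].
  by elim/big_ind: _ => // [|j /eqP <-]; [apply: GD|].
exists (\max_(j <- s) j).+1; split=> [i lt_i|].
  rewrite big_seq_cond big1 // => j /andP[js /eqP ji].
  by move: lt_i; rewrite -ji ltnNge leq_bigmax_seq.
rewrite (exchange_big_dep xpredT) //= big_seq [RHS]big_seq; apply: eq_bigr => j js.
have lt_j : (j < (\max_(j <- s) j).+1)%N by rewrite ltnS leq_bigmax_seq.
by rewrite (big_pred1 (Ordinal lt_j)) // => i; rewrite /= eq_sym.
Qed.

Lemma decomposes_uniq v f g : decomposes v f -> decomposes v g -> f = g.
Proof.
have [G_sub _ G_uniq] := grG.
move=> [Gf [N [fN vf]]] [Gg [N' [gN vg]]].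
have widen h M M' : (forall i, (M <= i)%N -> h i = 0) -> (M <= M')%N ->
    \sum_(i < M) h i = \sum_(i <- iota 0 M') h i :> V.
  move=> h0 le_M; rewrite -(subnKC le_M) iotaD big_cat /= [X in _ + X]big_seq.
  rewrite [X in _ + X]big1 ?addr0 => [|i]; last by rewrite mem_iota => /andP[/h0].
  by rewrite -(big_mkord xpredT h) /index_iota subn0.
apply/funext => i; pose M := maxn i.+1 (maxn N N').
apply/eqP; rewrite -subr_eq0; apply/eqP.
apply: (G_uniq (iota 0 M) (fun i => f i - g i)); rewrite ?iota_uniq //.
- by move=> j; have [_ GB] := G_sub j; apply: GB.
- by rewrite sumrB -(widen _ N) ?leq_max ?leqnn ?orbT // -(widen _ N') ?leq_max ?leqnn ?orbT // -vf -vg subrr.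
- by rewrite mem_iota /= leq_max leqnn.
Qed.

(** A grading only asserts the existence of decompositions; [hcomp] is the
    resulting projection on the component of degree [i]. *)
Definition hcomp (i : nat) (v : V) : V := sval (cid (decomposes_ex v)) i.

Lemma hcompP v : decomposes v (hcomp^~ v).
Proof. exact: (svalP (cid (decomposes_ex v))). Qed.

Lemma hcomp_gr i v : G i (hcomp i v).
Proof. by have [] := hcompP v. Qed.

Lemma hcomp_eq v f i : decomposes v f -> hcomp i v = f i.
Proof. by move=> /(decomposes_uniq (hcompP v)) /(congr1 (fun f => f i)). Qed.

Lemma hcomp_sum v : exists N, v = \sum_(i < N) hcomp i v.
Proof. by have [_ [N [_ vE]]] := hcompP v; exists N. Qed.

Lemma hcomp_big v : exists N, forall i, (N <= i)%N -> hcomp i v = 0.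
Proof. by have [_ [N [v0 _]]] := hcompP v; exists N. Qed.

Lemma hcompB i u v : hcomp i (u - v) = hcomp i u - hcomp i v.
Proof.
apply: (@hcomp_eq _ (fun i => hcomp i u - hcomp i v)).
have [G_sub _ _] := grG.
split=> [j|]; first by have [_ GB] := G_sub j; apply: GB; apply: hcomp_gr.
have [_ [N [u0 uE]]] := hcompP u; have [_ [N' [v0 vE]]] := hcompP v.
exists (maxn N N'); split=> [j|].
  by rewrite geq_max => /andP[/u0 -> /v0 ->]; rewrite subrr.
rewrite sumrB {1}uE {1}vE; congr (_ - _).
  rewrite (big_ord_widen (maxn N N') (fun j => hcomp j u)) ?leq_maxl //= big_mkcond.
  by apply: eq_bigr => j _; case: ltnP => // /u0.
rewrite (big_ord_widen (maxn N N') (fun j => hcomp j v)) ?leq_maxr //= big_mkcond.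
by apply: eq_bigr => j _; case: ltnP => // /v0.
Qed.

Lemma hcomp0 i : hcomp i 0 = 0.
Proof. by have := hcompB i 0 0; rewrite !subrr. Qed.

Lemma hcompN i v : hcomp i (- v) = - hcomp i v.
Proof. by rewrite -sub0r hcompB hcomp0 sub0r. Qed.

Lemma hcompD i u v : hcomp i (u + v) = hcomp i u + hcomp i v.
Proof. by rewrite -{1}[v]opprK hcompB hcompN opprK. Qed.

Lemma hcomp_homog i j v : G j v -> hcomp i v = if i == j then v else 0.
Proof.
move=> Gv; apply: (@hcomp_eq _ (fun i => if i == j then v else 0)).
have [G_sub _ _] := grG.
split=> [l|]; first by case: eqP => [->|_] //; have [] := G_sub l.
exists j.+1; split=> [l|]; first by case: eqP => // ->; rewrite ltnn.
rewrite (bigD1 ord_max) //= eqxx big1 ?addr0 // => l ne_l.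
by case: eqP => // lj; case/eqP: ne_l; apply: val_inj.
Qed.

End Components.

(** * Colon ideals and the degree filtration *)

Section ColonIdeals.
Variables (k : fieldType) (R : comAlgType k) (G : nat -> R -> Prop).
Hypothesis stG : standard_graded G.
Local Notation comp := (hcomp (std_grading stG)).
Implicit Types (r s u v z : R) (i j l b n q m : nat).

Lemma std_one : G 0 1.
Proof. by rewrite -(scale1r (1 : R)); apply: std_alg. Qed.

Lemma comp_id j r : G j r -> comp j r = r.
Proof. by move=> Gr; rewrite (hcomp_homog _ _ Gr) eqxx. Qed.

Lemma comp_scale i c r : comp i (c *: r) = c *: comp i r.
Proof.
apply: (@hcomp_eq _ _ _ _ (fun i => c *: comp i r)); split=> [j|].
  by apply: (std_scale stG); apply: hcomp_gr.
have [_ [N [r0 rE]]] := hcompP (std_grading stG) r; exists N; split=> [j /r0 ->|].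
  exact: scaler0.
by rewrite {1}rE scaler_sumr.
Qed.

Lemma comp_mul j s i r : G j s ->
  comp i (s * r) = if (j <= i)%N then s * comp (i - j) r else 0.
Proof.
move=> Gs.
apply: (@hcomp_eq _ _ _ _ (fun i => if (j <= i)%N then s * comp (i - j) r else 0)).
split=> [l|].
  case: ifP => [le_j|_]; last exact: (std_zero stG).
  by rewrite -{1}(subnKC le_j); apply: (std_mul stG) => //; apply: hcomp_gr.
have [_ [N [r0 rE]]] := hcompP (std_grading stG) r; exists (j + N)%N; split=> [l le_l|].
  by case: ifP => // _; rewrite r0 ?mulr0 //; lia.
rewrite big_split_ord /= [X in X + _]big1 ?add0r => [|l _]; last by rewrite leqNgt ltn_ord.
by rewrite {1}rE mulr_sumr; apply: eq_bigr => l _; rewrite leq_addr addKn.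
Qed.

Definition ge_deg n r : Prop := forall j, (j < n)%N -> comp j r = 0.

Lemma ge_deg_sum n (T : Type) (t : seq T) (P : pred T) (f : T -> R) :
  (forall x, P x -> ge_deg n (f x)) -> ge_deg n (\sum_(i <- t | P i) f i).
Proof.
move=> fn; elim/big_ind: _ => [j _|u v un vn j lt_j|]; first exact: hcomp0.
  by rewrite hcompD un // vn // addr0.
exact: fn.
Qed.

Lemma ge_deg_homog n i r : G i r -> (n <= i)%N -> ge_deg n r.
Proof.
move=> Gr le_n j lt_j; rewrite (hcomp_homog _ _ Gr); case: eqP => // ji; move: lt_j; rewrite ji.
by rewrite ltnNge le_n.
Qed.

Lemma ge_degMl n i s r : G i s -> ge_deg n r -> ge_deg (i + n) (s * r).
Proof.
move=> Gs rn j lt_j; rewrite (comp_mul _ _ Gs); case: ifP => // le_i.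
by rewrite rn ?mulr0 //; lia.
Qed.

Lemma ge_degW n n' r : (n' <= n)%N -> ge_deg n r -> ge_deg n' r.
Proof. by move=> le_n rn j lt_j; apply/rn/(leq_trans lt_j). Qed.

Lemma ge_degM n n' s r : ge_deg n s -> ge_deg n' r -> ge_deg (n + n') (s * r).
Proof.
move=> sn rn; have [N ->] := hcomp_sum (std_grading stG) s.
rewrite mulr_suml; apply: ge_deg_sum => i _.
have [le_n|lt_i] := leqP n i; last by rewrite sn // mul0r => j _; apply: hcomp0.
apply: (ge_degW (n := i + n')); first by rewrite leq_add2r.
by apply: ge_degMl rn; apply: hcomp_gr.
Qed.

Lemma ge_deg_is_ideal n : is_ideal (ge_deg n).
Proof.
split=> [j _|u v un vn j lt_j|s r rn]; first exact: hcomp0.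
  by rewrite hcompD un // vn // addr0.
by apply: (@ge_degM 0).
Qed.

(** A monomial of positive degree is a variable times a monomial of smaller
    degree. *)
Lemma irrelevant_pow_homog n i r : G i r -> (n <= i)%N -> ideal_pow (irrelevant G) n r.
Proof.
elim: n i r => [|n IH] [|i] r // Gr le_n.
have [_ _ _ [nv [x px]]] := stG.
have [p p_gr <-] := homogeneous_lift stG px Gr.
rewrite /poly_eval /mmap big_seq.
apply: ideal_sum => [|m /(dhomog_mf p_gr) deg_m]; first exact: ideal_pow_is_ideal.
have [j mj] : exists j : 'I_nv, m j != 0%N.
  apply/existsP; rewrite -negb_forall; apply/negP => /forallP m0.
  have : mdeg m = 0%N by rewrite mdegE big1 // => j _; apply/eqP/m0.
  by rewrite deg_m.
have -> : m = (U_(j) + (m - U_(j)))%MM by rewrite addmC submK // lep1mP.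
rewrite commr_mmap1_M; last by move=> *; apply: mulrC.
rewrite mmap1U mulrCA; apply: ideal_gen_mem.
have [x1 _] := px; eexists; eexists; split; last reflexivity.
  by apply: ideal_gen_mem; exists 1%N; last exact: x1.
apply: (IH i) => //.
have Xm : mpoly_gr i%:Z (p@_(U_(j) + (m - U_(j)))%MM *: 'X_[m - U_(j)]).
  apply: dhomogZ; rewrite dhomogX /=.
  have := mdegD U_(j) (m - U_(j)); rewrite mdeg1 addmC submK ?lep1mP // deg_m => -[->].
  exact: eqxx.
by have := poly_eval_gr stG px Xm; rewrite /poly_eval mmapZ mmapX.
Qed.

Lemma irrelevant_powP n r : ideal_pow (irrelevant G) n r <-> ge_deg n r.
Proof.
split=> [|rn].
  elim: n r => [|n IH] r; first by [].
  apply: (ideal_gen_sub (ge_deg_is_ideal n.+1)) => _ [s [t [irr_s /IH tn ->]]].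
  apply: (@ge_degM 1) => //.
  apply: (ideal_gen_sub (ge_deg_is_ideal 1) _ irr_s) => u [i i_gt0 Gu].
  exact: ge_deg_homog Gu i_gt0.
have [N ->] := hcomp_sum (std_grading stG) r.
apply: ideal_sum => [|i _]; first exact: ideal_pow_is_ideal.
have [le_n|lt_i] := leqP n i; first exact: irrelevant_pow_homog (hcomp_gr _ _ _) le_n.
by rewrite rn //; have [] := ideal_pow_is_ideal (irrelevant G) n.
Qed.

Variable y : R.
Hypothesis Gy : G 1%N y.
Hypothesis y_reg : forall r, y * r = 0 -> r = 0.

Lemma y_pow_gr q : G q (y ^+ q).
Proof. by have := std_exp stG q Gy; rewrite mul1n. Qed.

Lemma y_pow_reg q r : y ^+ q * r = 0 -> r = 0.
Proof.
elim: q r => [|q IH] r; first by rewrite expr0 mul1r.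
by rewrite exprS -mulrA => /y_reg /IH.
Qed.

(** The quotient [R / (1 - y) R] is the degree 0 part of [R[1/y]], and
    [low_deg b] is the preimage in [R] of the image of the components of degree
    less than [b]. *)
Definition low_deg b r : Prop :=
  exists u v, (forall j, (b <= j)%N -> comp j u = 0) /\ r = u + (v - y * v).

Lemma low_degD b c r s : low_deg b r -> low_deg b s -> low_deg b (c *: r + s).
Proof.
move=> [u [v [u0 ->]]] [u' [v' [u'0 ->]]].
exists (c *: u + u'), (c *: v + v'); split=> [j le_b|].
  by rewrite hcompD comp_scale u0 // u'0 // scaler0 addr0.
rewrite mulrDr -scalerAr !scalerDr scalerN opprD addrACA; congr (_ + _).
by rewrite addrACA.
Qed.

Lemma low_deg_small b u : (forall j, (b <= j)%N -> comp j u = 0) -> low_deg b u.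
Proof. by move=> u0; exists u, 0; rewrite mulr0 subr0 addr0. Qed.

Lemma low_deg_homog b i r : G i r -> (i < b)%N -> low_deg b r.
Proof.
move=> Gr lt_i; apply: low_deg_small => j le_b; rewrite (hcomp_homog _ _ Gr).
by case: eqP => // ji; move: lt_i; rewrite -ji ltnNge le_b.
Qed.

Lemma low_deg0 b : low_deg b 0.
Proof. by apply: low_deg_small => j _; apply: hcomp0. Qed.

Lemma low_deg_diff b v : low_deg b (v - y * v).
Proof. by exists 0, v; rewrite add0r; split=> // j _; apply: hcomp0. Qed.

Lemma low_deg_sum b (T : Type) (t : seq T) (P : pred T) (f : T -> R) :
  (forall x, P x -> low_deg b (f x)) -> low_deg b (\sum_(i <- t | P i) f i).
Proof.
move=> fb; elim/big_ind: _ => [|u v ub vb|]; [exact: low_deg0 | | exact: fb].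
by rewrite -[u]scale1r; apply: low_degD.
Qed.

Lemma low_degMy b r : low_deg b (y * r) <-> low_deg b r.
Proof.
split=> lr.
  have -> : r = 1 *: (r - y * r) + y * r by rewrite scale1r subrK.
  by apply: low_degD => //; apply: low_deg_diff.
have -> : y * r = (-1) *: (r - y * r) + r by rewrite scaleN1r opprB subrK.
by apply: low_degD => //; apply: low_deg_diff.
Qed.

Lemma low_degMyn b q r : low_deg b (y ^+ q * r) <-> low_deg b r.
Proof.
elim: q => [|q IH]; first by rewrite expr0 mul1r.
by rewrite exprS -mulrA low_degMy.
Qed.

Lemma low_deg_of_div b i q s z : G i s -> s = y ^+ q * z -> (i < b + q)%N -> low_deg b s.
Proof.
move=> Gs sE lt_i; rewrite -(comp_id Gs) sE (comp_mul _ _ (y_pow_gr q)).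
case: ifP => [le_q|_]; last exact: low_deg0.
by apply/low_degMyn; apply: low_deg_homog (hcomp_gr _ _ _) _; lia.
Qed.

(** If [s = u + (1 - y) v] with [u] in degrees less than [b], then comparing
    components in degrees at least [b] shows that each component of [v] is [y]
    times the previous one, except at the degree of [s]. Above this degree they
    vanish because [v] has finitely many components and [y] is regular. *)
Lemma low_deg_div b q s : G (b + q)%N s -> low_deg b s -> exists z, s = y ^+ q.+1 * z.
Proof.
move=> Gs [u [v [u0 sE]]].
(* The component of [y * v] in degree [j] is [y * w j]. *)
pose w j := if j is j'.+1 then comp j' v else 0.
have compE j : (b <= j)%N -> comp j s = comp j v - y * w j.
  move=> le_b; rewrite sE hcompD u0 // add0r hcompB (comp_mul _ _ Gy).
  by case: j {le_b} => [|j] /=; rewrite ?mulr0 // subn1.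
have wS j : (b <= j)%N -> j <> (b + q)%N -> w j.+1 = y * w j.
  move=> le_b ne_j; apply/eqP; rewrite -subr_eq0 -[w j.+1]/(comp j v) -compE //.
  by rewrite (hcomp_homog _ _ Gs); case: (j =P _) => [/ne_j|]//.
have w_low p : (p <= q)%N -> w (b + p)%N = y ^+ p * w b.
  elim: p => [|p IH] le_p; first by rewrite addn0 expr0 mul1r.
  by rewrite addnS wS ?IH ?exprS ?mulrA ?leq_addr //; lia.
have w_high p : w (b + q + p).+1 = y ^+ p * w (b + q).+1.
  elim: p => [|p IH]; first by rewrite addn0 expr0 mul1r.
  by rewrite addnS wS ?IH ?exprS ?mulrA //; lia.
have v0 : w (b + q).+1 = 0.
  have [N vN] := hcomp_big (std_grading stG) v.
  apply: (y_pow_reg (q := N)); rewrite -w_high; apply: vN; lia.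
exists (- w b); rewrite -(comp_id Gs) compE ?leq_addr // -[comp _ v]/(w (b + q).+1) v0.
by rewrite sub0r w_low // mulrN exprS mulrA.
Qed.

Lemma low_deg_separation b r : ~ low_deg b r ->
  exists lam : R -> k, [/\ forall c s s', lam (c *: s + s') = c * lam s + lam s',
    forall s, low_deg b s -> lam s = 0 & lam r <> 0].
Proof.
move=> nr; pose A s d := low_deg b (s - d *: r).
have [|lam [lin lamA]] := @linear_functional_extension k _ A.
  split; first split.
  - by rewrite /A scale0r subr0; apply: low_deg0.
  - move=> c s s' d d' As As'; rewrite /A.
    have -> : c *: s + s' - (c * d + d') *: r = c *: (s - d *: r) + (s' - d' *: r).
      by rewrite scalerDl opprD addrACA scalerBr scalerA.
    exact: low_degD.
  - move=> d; rewrite /A sub0r => Ad; have [//|d_neq0] := eqVneq d 0; case: nr.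
    have -> : r = - d^-1 *: (- (d *: r)) + 0.
      by rewrite addr0 scalerN scaleNr opprK scalerA mulVf // scale1r.
    by apply: low_degD => //; apply: low_deg0.
exists lam; split=> // [s ls|].
  by apply: lamA; rewrite /A scale0r subr0.
have -> : lam r = 1 by apply: lamA; rewrite /A scale1r subrr; apply: low_deg0.
by apply/eqP/oner_neq0.
Qed.

(** The form taken by the faithfulness of the lowest component of the canonical
    module when it is expressed in [R / (1 - y) R]. *)
Definition no_low_ideal b : Prop :=
  forall i r, G i r -> (forall s, low_deg b (r * s)) -> r = 0.

Local Notation colon_eq b i :=
  (eq_ideal (colon (ideal_pow (ideal_of_seq [:: y]) i) (ideal_pow (irrelevant G) b))
            (ideal_pow (irrelevant G) i)).

(** If the ideal generated by [r] has low degree, then so does [r] itself, which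
    modulo [1 - y] is therefore equal to an element [r'] of degree [i - 1].
    Multiplying [r'] by [m ^ b] gives elements of low degree and of degree at
    least [b + i - 1], hence multiples of [y ^ i]. *)
Lemma colon_no_low_ideal b i : (b <= i)%N -> colon_eq b i -> no_low_ideal b.
Proof.
move=> le_b colonE j r Gr lr; pose q := (i + j - b)%N.
have Gyr : G (b + q)%N (y ^+ i * r).
  by rewrite subnKC; [apply: (std_mul stG) => //; apply: y_pow_gr | lia].
have [|z yrE] := low_deg_div Gyr; first by apply/low_degMyn; have := lr 1; rewrite mulr1.
have {}yrE : y ^+ i * r = if (q.+1 <= b + q)%N then y ^+ q.+1 * comp (b + q - q.+1) z else 0.
  by rewrite -(comp_id Gyr) yrE (comp_mul _ _ (y_pow_gr _)).
have [b0|b_gt0] := posnP b.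
  by apply: (y_pow_reg (q := i)); rewrite yrE b0 ltnn.
pose r' := y ^+ (i - b) * comp b.-1 z.
have Gr' : G i.-1 r'.
  have -> : i.-1 = (i - b + b.-1)%N by lia.
  by apply: (std_mul stG); [apply: y_pow_gr | apply: hcomp_gr].
have r'E : y ^+ j.+1 * r' = y ^+ i * r.
  rewrite yrE ifT; last by lia.
  by rewrite mulrA -exprD; congr (_ ^+ _ * comp _ _); rewrite /q; lia.
suff r'0 : r' = 0 by apply: (y_pow_reg (q := i)); rewrite -r'E r'0 mulr0.
have lr' s : low_deg b (r' * s).
  by apply/(low_degMyn b j.+1); rewrite mulrA r'E -mulrA; apply/low_degMyn.
rewrite -(comp_id Gr'); suff /irrelevant_powP : ideal_pow (irrelevant G) i r' by apply; lia.
apply/colonE => s /irrelevant_powP sb; apply/principal_powP.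
have [N ->] := hcomp_sum (std_grading stG) s.
rewrite mulr_sumr; elim/big_ind: _ => [|u v [t ->] [t' ->]|l _]; first by exists 0; rewrite mulr0.
  by exists (t + t'); rewrite mulrDr.
have [le_l|lt_l] := leqP b l; last by exists 0; rewrite sb // !mulr0.
have [|t ->] := @low_deg_div b (i.-1 + l - b) _ _ (lr' (comp l s)).
  by rewrite subnKC; [apply: (std_mul stG) => //; apply: hcomp_gr | lia].
exists (y ^+ (l - b) * t); rewrite mulrA -exprD; congr (_ ^+ _ * _); lia.
Qed.

Variables (M : lmodType R) (GM : int -> M -> Prop).
Hypothesis grM : graded_module G GM.
Hypothesis M_repr : forall t w, GM t w -> exists c, represents G y t w c.
Hypothesis M_onto : forall t c, series_on y c -> series_degree G t c ->
  exists w c', [/\ GM t w, represents G y t w c' &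
    forall j s m, G j s -> c' m s = c m s].

(** If some [r * s] were not of low degree, a functional on [R / (1 - y) R]
    vanishing in low degree would separate it. This functional is an element
    of [GM] that [r] does not kill. *)
Lemma annihilator_low_deg b i r : G i r -> (forall w, GM (1 - b%:Z) w -> r *: w = 0) ->
  forall s, low_deg b (r * s).
Proof.
move=> Gr r0 s; apply: contrapT => /low_deg_separation[lam [lin lam0 lam_rs]].
have lamD u v : lam (u + v) = lam u + lam v by have := lin 1 u v; rewrite scale1r mul1r.
(* In degree [1 - b], the coefficient of [y ^ m] is seen on degree [m + b]. *)
pose c m u := lam (comp (m + b) u).
have ser_c : series_on y c.
  rewrite /c; split=> [m d u v|u|m u].
  - by rewrite hcompD comp_scale lin.
  - rewrite (comp_mul _ _ Gy) add0n; case: ifP => b_gt0; last exact/lam0/low_deg0.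
    by apply/lam0/low_degMy/(low_deg_homog (hcomp_gr _ _ _)); lia.
  - rewrite (comp_mul _ _ Gy) addSn /= subn1 /=.
    set z := comp _ _; apply/eqP; rewrite -subr_eq0; apply/eqP.
    have := lin (-1) z (y * z); rewrite mulN1r [RHS]addrC => <-; apply: lam0.
    have -> : (-1) *: z + y * z = (-1) *: (z - y * z) + 0.
      by rewrite addr0 !scaleN1r opprB addrC.
    by apply: low_degD; [apply: low_deg_diff | apply: low_deg0].
have deg_c : series_degree G (1 - b%:Z) c.
  move=> j u m Gu; rewrite /c (hcomp_homog _ _ Gu); case: ((m + b)%N =P j) => [<- _|_]; first by lia.
  by rewrite lam0 ?eqxx //; apply: low_deg0.
have [w [c' [Gw [_ _ annE] c'E]]] := M_onto ser_c deg_c.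
have c'0 := proj1 (annE _ _ Gr) (r0 w Gw).
case: lam_rs; have [N ->] := hcomp_sum (std_grading stG) s.
rewrite mulr_sumr; elim/big_ind: _ => [|u v lu lv|j _]; first exact/lam0/low_deg0.
  by rewrite lamD lu lv addr0.
have Grs : G (i + j)%N (r * comp j s) by apply: (std_mul stG Gr); apply: hcomp_gr.
have [lt_b|le_b] := ltnP (i + j) b; first exact/lam0/(low_deg_homog Grs).
have := c'0 (i + j - b)%N (comp j s); rewrite (c'E _ _ _ Grs) /c subnK //.
by rewrite comp_id.
Qed.

(** By [low_deg_div], [r * s] is divisible by a power of [y] that exceeds the
    only exponent at which the functional could be nonzero. *)
Lemma low_deg_annihilator b i r : G i r -> (forall s, low_deg b (r * s)) ->
  forall w, GM (1 - b%:Z) w -> r *: w = 0.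
Proof.
move=> Gr lr w Gw; have [c [[lin c0 cS] deg_c annE]] := M_repr Gw.
apply/(annE _ _ Gr) => m s.
have cD u v : c m (u + v) = c m u + c m v by have := lin m 1 u v; rewrite scale1r mul1r.
have [N ->] := hcomp_sum (std_grading stG) s.
rewrite mulr_sumr; elim/big_ind: _ => [|u v lu lv|j _].
- by have := lin m (-1) 0 0; rewrite scaler0 addr0 mulN1r addNr.
- by rewrite cD lu lv addr0.
have Grs : G (i + j)%N (r * comp j s) by apply: (std_mul stG Gr); apply: hcomp_gr.
apply/eqP/negPn/negP => c_neq0; have m_eq := deg_c _ _ _ Grs c_neq0.
have ijE : (i + j = b + m)%N by lia.
have [|z zE] := @low_deg_div b m (r * comp j s) _ (lr _); first by rewrite -ijE.
move: c_neq0; rewrite zE; apply/negP/negPn/eqP.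
by elim: m z {cD m_eq ijE zE} => [|m IH] z; rewrite exprS -mulrA ?c0 // cS.
Qed.

Variable a : int.
Hypothesis a_min : forall (t : int) w, GM t w -> w <> 0 -> - a <= t.

(** In degree [1 - b] the module is 0, hence annihilated by 1. *)
Lemma low_deg_full b r : (1 - b%:Z < - a) -> low_deg b r.
Proof.
move=> lt_a; rewrite -[r]mul1r; apply: (annihilator_low_deg std_one) => w Gw.
rewrite scale1r; apply: contrapT => /(a_min Gw).
by rewrite leNgt lt_a.
Qed.

(** Otherwise 1 would be a multiple of [1 - y]. *)
Lemma a_ge : -1 <= a.
Proof.
rewrite leNgt; apply/negP => lt_a.
have [|z /(congr1 (comp 0))] := @low_deg_div 0 0 1 std_one.
  by apply: low_deg_full; lia.
rewrite comp_id; last exact: std_one.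
rewrite expr1 (comp_mul _ _ Gy) /=.
by apply/eqP/oner_neq0.
Qed.

Variable b : nat.
Hypothesis aE : a + 1 = b%:Z.

Lemma high_degree_div i s : G i s -> (b <= i)%N -> exists z, s = y ^+ (i - b) * z.
Proof.
move=> Gs; rewrite leq_eqVlt => /orP[/eqP <-|lt_b].
  by exists s; rewrite subnn expr0 mul1r.
have [||z ->] := @low_deg_div b.+1 (i - b.+1)%N s; first by rewrite subnKC.
  by apply: low_deg_full; lia.
by exists z; rewrite subnSK.
Qed.

Lemma faithful_no_low_ideal : faithful (submod_gen (GM (- a))) <-> no_low_ideal b.
Proof.
have atE : - a = 1 - b%:Z by lia.
split=> [faith i r Gr lr|nolow r r_ann].
  apply: faith => _ [s [Gs ->]]; rewrite big_seq scaler_sumr big1 // => p ps.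
  by rewrite scalerA mulrC -scalerA (low_deg_annihilator Gr lr) ?scaler0 // -atE; apply: Gs.
have r0 w : GM (- a) w -> r *: w = 0.
  move=> Gw; apply: r_ann; exists [:: (1, w)]; rewrite big_seq1 scale1r; split=> //.
  by move=> p; rewrite inE => /eqP ->.
have [N rE] := hcomp_sum (std_grading stG) r.
rewrite rE big1 // => i _; apply: (nolow i); first exact: hcomp_gr.
apply: (annihilator_low_deg (hcomp_gr _ _ _)) => w; rewrite -atE => Gw.
have [[_ _ M_uniq] M_act] := grM.
pose f (j : int) := if j + a is Posz l then comp l r *: w else 0.
have Gf (j : int) : GM j (f j).
  rewrite /f; case E: (j + a) => [l|l]; last by have [[/(_ j)[]]] := grM.
  have -> : j = l%:Z + - a by rewrite -E addrK.
  by apply: M_act => //; apply: hcomp_gr.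
pose t := [seq (l : nat)%:Z - a | l <- iota 0 N].
have t_uniq : uniq t by rewrite map_inj_uniq ?iota_uniq // => l l' /addIr [].
have ft : \sum_(j <- t) f j = 0.
  rewrite big_map -{2}(r0 w Gw) rE scaler_suml -(big_mkord xpredT (fun l => comp l r *: w)).
  by rewrite /index_iota subn0; apply: eq_bigr => l _; rewrite /f subrK.
have := M_uniq t f t_uniq Gf ft ((i : nat)%:Z - a); rewrite /f subrK; apply.
by apply: (map_f (fun l : nat => l%:Z - a)); rewrite mem_iota /= ltn_ord.
Qed.

Lemma ge_deg_div i r : ge_deg (i + b) r -> exists z, r = y ^+ i * z.
Proof.
move=> rn; have [N ->] := hcomp_sum (std_grading stG) r.
elim/big_ind: _ => [|u v [z ->] [z' ->]|j _]; first by exists 0; rewrite mulr0.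
  by exists (z + z'); rewrite mulrDr.
have [le_ib|lt_j] := leqP (i + b) j; last by exists 0; rewrite rn // mulr0.
have [z ->] := high_degree_div (hcomp_gr (std_grading stG) j r) (leq_trans (leq_addl _ _) le_ib).
by exists (y ^+ (j - b - i) * z); rewrite mulrA -exprD; congr (_ ^+ _ * _); lia.
Qed.

(** For [r] in the colon ideal and [j < i], the product of the component of
    degree [j] by an element of degree [b] is divisible by [y ^ i] and has degree
    less than [b + i]: it has low degree. Modulo [1 - y], every element of [R] is
    a sum of elements of degree at most [b], which powers of [y] raise to degree
    [b]. *)
Lemma no_low_ideal_colon i : no_low_ideal b -> colon_eq b i.
Proof.
move=> nolow r; split=> [r_colon|/irrelevant_powP rn s /irrelevant_powP sn]; last first.
  exact/principal_powP/ge_deg_div/ge_degM.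
apply/irrelevant_powP => j lt_j; apply: (nolow j) => [|s]; first exact: hcomp_gr.
have top s' : G b s' -> low_deg b (comp j r * s').
  move=> Gs'; have /r_colon/principal_powP[z rsE] : ideal_pow (irrelevant G) b s'.
    exact: irrelevant_pow_homog Gs' (leqnn b).
  have E : comp j r * s' = comp (b + j) (r * s').
    by rewrite [r * s']mulrC (comp_mul _ _ Gs') leq_addr addKn mulrC.
  have [le_i|lt_i] := leqP i (b + j); last first.
    by rewrite E rsE (comp_mul _ _ (y_pow_gr i)) leqNgt lt_i; apply: low_deg0.
  apply: (@low_deg_of_div b (b + j) i _ (comp (b + j - i) z)); last by rewrite ltn_add2l.
    by rewrite addnC; apply: (std_mul stG) => //; apply: hcomp_gr.
  by rewrite E rsE (comp_mul _ _ (y_pow_gr i)) le_i.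
have [N ->] := hcomp_sum (std_grading stG) s.
rewrite mulr_sumr; apply: low_deg_sum => l _.
have Gl := hcomp_gr (std_grading stG) l s.
have [le_l|lt_b] := leqP l b.
  apply/(low_degMyn b (b - l)); rewrite mulrCA; apply: top.
  by rewrite -(subnK le_l) addnK; apply: (std_mul stG) => //; apply: y_pow_gr.
have [z sE] := high_degree_div Gl (ltnW lt_b).
have -> : comp l s = y ^+ (l - b) * comp b z.
  by rewrite -{1}(comp_id Gl) sE (comp_mul _ _ (y_pow_gr _)) leq_subr subKn // ltnW.
rewrite mulrCA; apply/low_degMyn; apply: top.
exact: hcomp_gr.
Qed.

End ColonIdeals.

(** * Regularity of the parameter and conclusion *)

Section LinearParameter.
Variables (k : fieldType) (R : comAlgType k) (G : nat -> R -> Prop).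

Lemma ideal_of_nil (r : R) : ideal_of_seq [::] r -> r = 0.
Proof.
apply: (ideal_gen_sub (I := fun r : R => r = 0)) => //.
by split=> // [u v -> ->|u v ->]; rewrite ?addr0 ?mulr0.
Qed.

(** Some element of the irrelevant ideal is regular, and one of its powers is
    a multiple of the parameter. *)
Lemma parameter_regular (y : R) : cohen_macaulay G -> krull_dim R 1 ->
  system_of_parameters G [:: y] -> forall r, y * r = 0 -> r = 0.
Proof.
move=> [d [dim_d [[xs [reg_xs xs_irr size_xs]] _]]] dim1 [_ _ [N powN]] r yr0.
have d1 := krull_dim_uniq dim_d dim1.
case: xs reg_xs xs_irr size_xs => [|z [|]] //=; rewrite d1 // => -[z_reg _] z_irr _.
have z_reg' s : z * s = 0 -> s = 0.
  move=> zs0; apply: ideal_of_nil; apply: (z_reg 0%N) => //=.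
  by rewrite zs0; exists [::]; rewrite big_nil.
have /powN/ideal_of_seq1P[s zN] : ideal_pow (irrelevant G) N (z ^+ N).
  by apply: ideal_pow_exp; apply: z_irr; rewrite inE.
have : z ^+ N * r = 0 by rewrite zN mulrAC yr0 mul0r.
elim: N {powN zN} => [|N IH]; first by rewrite expr0 mul1r.
by rewrite exprS -mulrA => /z_reg'.
Qed.

Lemma linear_form_coefficients n (x : 'I_n -> R) (y : R) :
  standard_graded G -> presentation G x -> G 1%N y ->
  exists c : 'I_n -> k, y = \sum_i c i *: x i.
Proof.
move=> stG px Gy; have [p p_gr <-] := homogeneous_lift stG px Gy.
exists (fun i => p@_U_(i)); rewrite -(poly_eval_lin _ x xpredT); congr poly_eval.
apply/mpolyP => m; rewrite raddf_sum /=.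
have [/mdeg1P[i /eqP ->]|m1] := boolP (mdeg m == 1%N).
  rewrite (bigD1 i) //= mcoeffZ mcoeffXU eqxx mulr1 big1 ?addr0 // => j /negPf ne_j.
  by rewrite mcoeffZ mcoeffXU ne_j mulr0.
rewrite (dhomog_nemf_coeff p_gr m1) big1 // => j _.
rewrite mcoeffZ mcoeffX; case: eqP => [em|_]; last by rewrite mulr0.
by rewrite -em mdeg1 in m1.
Qed.

End LinearParameter.

Theorem corollary2p11 (k : fieldType) (R : comAlgType k) (G : nat -> R -> Prop)
    (hG : standard_graded G) (hCM : cohen_macaulay G) (hdim : krull_dim R 1)
    (omega : lmodType R) (Gomega : int -> omega -> Prop)
    (homega : canonical_module G Gomega)
    (a : int) (ha : a_invariant Gomega a)
    (y1 : R) (hy1 : G 1%N y1) (hsop : system_of_parameters G [:: y1]) :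
  let m := irrelevant G in
  let J := ideal_of_seq [:: y1] in
  let cond_a := faithful (submod_gen (Gomega (- a))) in
  let cond_b := forall i : int,
    eq_ideal (colon (ideal_powz J i) (ideal_powz m (a + 1))) (ideal_powz m i) in
  let cond_c := exists i : int, a + 1 <= i /\
    eq_ideal (colon (ideal_powz J i) (ideal_powz m (a + 1))) (ideal_powz m i) in
  (cond_a <-> cond_b) /\ (cond_b <-> cond_c).
Proof.
move=> m J cond_a cond_b cond_c.
have y_reg := parameter_regular hCM hdim hsop.
have [grM [n [x [g [F [px _ isoM]]]]]] := homega.
have [c yE] := linear_form_coefficients hG px hy1.
have [i0 c_i0] : exists i0, c i0 != 0.
  apply: contrapT => c0; have y0 : y1 = 0.
    rewrite yE big1 // => i _.
    by have [->|ci] := eqVneq (c i) 0; [rewrite scale0r | case: c0; exists i].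
  by have := y_reg 1; rewrite y0 mul0r => /(_ erefl)/eqP; rewrite oner_eq0.
pose x' := new_coordinates x i0 c.
have x'_i0 : x' i0 = y1 by rewrite /x' /new_coordinates eqxx yE.
have Gy : G 1%N (\sum_i c i *: x i) by rewrite -yE.
have px' : presentation G x' := new_presentation px c_i0 Gy.
have isoM' := new_iso_Ext c_i0 isoM.
have y_reg' r : x' i0 * r = 0 -> r = 0 by rewrite x'_i0; apply: y_reg.
have y_par i : exists N r, x' i ^+ N = x' i0 * r.
  have [_ _ [N powN]] := hsop; exists N; rewrite x'_i0; apply/ideal_of_seq1P/powN/ideal_pow_exp.
  by apply: ideal_gen_mem; exists 1%N => //; have [] := px'.
have M_neq0 : exists t w, Gomega t w /\ w <> 0.
  by have [[w Gw w0] _] := ha; exists (- a), w.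
have M_repr t w : Gomega t w -> exists c, represents G y1 t w c.
  by rewrite -x'_i0; apply: (canonical_represented hG px' y_reg' y_par grM isoM' M_neq0).
have M_onto t d : series_on y1 d -> series_degree G t d -> exists w c',
    [/\ Gomega t w, represents G y1 t w c' & forall j s l, G j s -> c' l s = d l s].
  by rewrite -x'_i0; apply: (represented_canonical hG px' y_reg' y_par grM isoM' M_neq0).
have [_ a_min] := ha.
have a_ge1 := a_ge hG hy1 y_reg M_onto a_min.
have [b aE] : exists b : nat, a + 1 = b%:Z by exists `|(a + 1)%R|%N; lia.
have condaE : cond_a <-> no_low_ideal hG y1 b.
  exact: (faithful_no_low_ideal hG hy1 y_reg grM M_repr M_onto aE).
have a_to_b : no_low_ideal hG y1 b -> cond_b.
  move=> nolow [i|i]; rewrite aE //.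
  exact: (no_low_ideal_colon hy1 y_reg M_onto a_min aE i nolow).
have c_to_a : cond_c -> no_low_ideal hG y1 b.
  move=> [[i|i] []]; rewrite aE // lez_nat => le_b.
  exact: (colon_no_low_ideal hy1 y_reg le_b).
have b_to_c : cond_b -> cond_c by move=> hb; exists (a + 1).
split; split.
- by move/condaE/a_to_b.
- by move/b_to_c/c_to_a/condaE.
- exact: b_to_c.
- by move/c_to_a/a_to_b.
Qed.
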